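(* For every $\epsilon>0$ there is a constant $C$, depending only on $\epsilon$, such that for every compact convex domain $W\subset\mathbb{R}^2$ with non-empty interior and every integer $k\ge 2$, the number of T-tessellations of $W$ built on any given set of $k$ lines is bounded as follows: $$\mathcal{N}(k)=\sup_{L:\ \#L=k}\#\mathcal{T}(L)\ \le\ C^k\left(\frac{k}{(\ln k)^{1-\epsilon}}\right)^{k-k/(\ln k)}.$$
   Context: Let $W$ be a compact convex domain in the plane with non-empty interior and boundary $\mathcal{B}$. A finite polygonal tessellation of $W$ is a finite partition of $W$ into convex sets with disjoint interiors, called cells, such that the boundary of each cell is a union of a finite number of line segments, called (inner) edges, and of parts of the boundary $\mathcal{B}$ of $W$. A segment of the tessellation is a maximal union of aligned and contiguous inner edges. A vertex is T-shaped if it has degree three and two of the incident edges are aligned, or if it has degree one and lies on $\mathcal{B}$ (only inner edges are counted in the degree of a vertex on $\mathcal{B}$). A T-tessellation is a polygonal tessellation such that all vertices in $W$ are T-shaped and no two segments are aligned (i.e. no two distinct segments lie on the same line). For a T-tessellation $T$, $L(T)$ denotes the set of lines supporting the segments of $T$. For a finite set $L$ of lines, $\mathcal{T}(L)=\{T: L(T)=L\}$ is the set of T-tessellations of $W$ whose segments are supported by $L$, with exactly one segment on each line of $L$. The supremum is over all sets $L$ of $k$ distinct lines. *)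

(* Defs.v *)
From mathcomp Require Import all_boot all_order all_algebra.
From mathcomp Require Import all_classical all_reals all_analysis.
Import Order.TTheory GRing.Theory Num.Theory numFieldNormedType.Exports.

Set Implicit Arguments.
Unset Strict Implicit.
Unset Printing Implicit Defensive.

Local Open Scope classical_set_scope.
Local Open Scope card_scope.
Local Open Scope ring_scope.

(* The plane is 'rV[R]_2; a tessellation is represented by its set of cells. *)

Definition boundary (T : topologicalType) (A : set T) : set T :=
  closure A `\` interior A.

Definition line_segment (R : realType) (a b : 'rV[R]_2) : set 'rV[R]_2 :=
  [set (1 - t) *: a + t *: b | t in `[0, 1]].

Definition is_line (R : realType) (l : set 'rV[R]_2) : Prop :=
  exists p u : 'rV[R]_2, u != 0 /\ l = [set p + t *: u | t in [set: R]].

Definition aligned (R : realType) (A B : set 'rV[R]_2) : Prop :=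
  exists l, [/\ is_line l, A `<=` l & B `<=` l].

Definition planar_domain (R : realType) (W : set 'rV[R]_2) : Prop :=
  [/\ compact W, convex_set W & interior W !=set0].

(* Edges are those of the planar graph drawn by the tessellation: the side of a
   cell is cut at every vertex in its relative interior, so that an edge is the
   whole common part of the two cells which it separates.  Cells are convex with
   disjoint interiors, hence two of them meet along a (possibly empty or
   one-point) segment; the degenerate cases are not edges. *)
Definition edge (R : realType) (T : set (set 'rV[R]_2)) (e : set 'rV[R]_2)
    : Prop :=
  (exists c c', [/\ T c, T c', c <> c' & e = c `&` c']) /\
  (exists a b, a <> b /\ e = line_segment a b).

(* Cells are closed with non-empty interior: "partition" is meant up to cell
   boundaries, and neither the allocation of boundary points to cells nor the
   insertion of degenerate cells gives a new tessellation. *)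
Definition polygonal_tessellation (R : realType) (W : set 'rV[R]_2)
    (T : set (set 'rV[R]_2)) : Prop :=
  [/\ finite_set T,
      \bigcup_(c in T) c = W,
      (forall c, T c -> [/\ closed c, convex_set c & interior c !=set0]),
      (forall c c', T c -> T c' -> c <> c' ->
        interior c `&` interior c' = set0) &
      (forall c, T c ->
        exists (E : set (set 'rV[R]_2)) (P : set 'rV[R]_2),
          [/\ finite_set E, E `<=` edge T, P `<=` boundary W &
              boundary c = (\bigcup_(e in E) e) `|` P])].

Definition incident_edges (R : realType) (T : set (set 'rV[R]_2))
    (v : 'rV[R]_2) : set (set 'rV[R]_2) :=
  [set e | edge T e /\ exists b, v <> b /\ e = line_segment v b].

(* Corners of W at which no inner edge ends are not vertices. *)
Definition vertex (R : realType) (T : set (set 'rV[R]_2)) (v : 'rV[R]_2)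
    : Prop :=
  incident_edges T v !=set0.

Definition has_degree (R : realType) (T : set (set 'rV[R]_2)) (v : 'rV[R]_2)
    (n : nat) : Prop :=
  incident_edges T v #= `I_n.

Definition T_shaped (R : realType) (W : set 'rV[R]_2)
    (T : set (set 'rV[R]_2)) (v : 'rV[R]_2) : Prop :=
  (has_degree T v 3 /\
    exists e e', [/\ incident_edges T v e, incident_edges T v e', e <> e' &
                     aligned e e']) \/
  (has_degree T v 1 /\ boundary W v).

Definition aligned_contiguous_union (R : realType) (T : set (set 'rV[R]_2))
    (s : set 'rV[R]_2) : Prop :=
  exists E : set (set 'rV[R]_2),
    [/\ E `<=` edge T, E !=set0, s = \bigcup_(e in E) e,
        (exists l, is_line l /\ s `<=` l) & connected s].

Definition segment (R : realType) (T : set (set 'rV[R]_2))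
    (s : set 'rV[R]_2) : Prop :=
  aligned_contiguous_union T s /\
  (forall s', aligned_contiguous_union T s' -> s `<=` s' -> s' = s).

Definition T_tessellation (R : realType) (W : set 'rV[R]_2)
    (T : set (set 'rV[R]_2)) : Prop :=
  [/\ polygonal_tessellation W T,
      (forall v, vertex T v -> T_shaped W T v) &
      (forall s s', segment T s -> segment T s' -> s <> s' -> ~ aligned s s')].

Definition supporting_lines (R : realType) (T : set (set 'rV[R]_2))
    : set (set 'rV[R]_2) :=
  [set l | is_line l /\ exists s, segment T s /\ s `<=` l].

Definition T_tessellations_on (R : realType) (W : set 'rV[R]_2)
    (L : set (set 'rV[R]_2)) : set (set (set 'rV[R]_2)) :=
  [set T | T_tessellation W T /\ supporting_lines T = L].

(* [counting A] is the number of elements of A, +oo when A is infinite. *)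
Definition max_T_tessellations (R : realType) (W : set 'rV[R]_2) (k : nat)
    : \bar R :=
  ereal_sup [set counting (T_tessellations_on W L) |
               L in [set L | L `<=` @is_line R /\ L #= `I_k]].

(* Main.v *)
(* A T-tessellation on k lines is encoded by the ends of its segments on the
   arrangement of the lines. Sweeping from left to right, it is determined by
   the left blocker of each segment and by the number of right ends that each
   segment stops, so that there are roughly k^k of them. Let D be a small
   multiple of ln k, and call a segment light if it stops at most D others; as
   there are 2k ends, at most 2k/(D+1) segments are heavy. If few light segments
   are blocked on the left by a light one, then nearly all left blockers are
   among O(k / ln k) heavy segments, which gives C^k (k / ln k)^k possibilities.
   Otherwise there are many pairs of light segments (s, b) with s ending on b.
   Remove such a pair and prolong the ends which it stopped: the result is a
   tessellation on k-2 lines, and the original one is recovered from it, from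
   the two lines (which locate the vertex of s and b) and from O(D) bits. Since there
   are only k^2 pairs of lines, this yields a recursion for the number of
   tessellations whose solution is again at most C^k (k / ln k)^k. Finally
   k^(k / ln k) = e^k and (ln k)^(k / ln k) are absorbed in C^k. *)
From mathcomp Require Import all_boot all_order all_algebra zify ring lra.

Set Implicit Arguments.
Unset Strict Implicit.
Unset Printing Implicit Defensive.

(** * Configurations of segments on an arrangement of lines *)

(** A tessellation enters the count only through an injective map to [valid] configurations, so
    deleting a segment and prolonging others never requires rebuilding convex cells. Pairs are
    removed rather than single segments because a single segment would have to be located along its
    line, at the price of a further factor of order k; the two lines of a pair meet in one point,
    which locates both segments for free. The gain comes from averaging: a configuration with at
    least [n0] light pairs is counted at least [n0] times among the k^2 ordered pairs of lines, so
    the recursion divides k^2 by [n0], while lightness keeps the cost of a reinsertion, exponential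
    in D, well below [n0]. Two lines thus contribute at most (C k / ln k)^2. The counting is done in
    natural numbers, with [trunc_log 2 k] in the place of ln k; the real exponent enters only at the
    end. *)

Ltac natlia :=
  repeat match goal with
  | H : ?P |- _ =>
    match P with
    | is_true (leq _ _) => fail 1
    | is_true (leq _ _ && leq _ _) => fail 1
    | is_true (~~ (_ == _)) => fail 1
    | @eq nat _ _ => fail 1
    | @eq (Equality.sort _) _ _ => fail 1
    | _ => match type of P with Prop => clear H end
    end
  end; lia.

Section Arrangement.

Variables (I : finType) (N : nat) (inc : I -> nat -> bool) (al be : I -> 'I_N).

Hypothesis inc_al : forall l, inc l (al l).
Hypothesis inc_be : forall l, inc l (be l).
Hypothesis inc_bounds : forall l z, inc l z -> al l <= z <= be l.
Hypothesis meet_uniq : forall l m z z', l != m ->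
  inc l z -> inc m z -> inc l z' -> inc m z' -> z = z'.
(** The ends of a chord are the boundary points of the domain on its line, so a chord end that lies
    on another line is an end of that chord as well. *)
Hypothesis extreme_compat : forall l m z, inc l z -> inc m z ->
  z = al m \/ z = be m -> z = al l \/ z = be l.

(* The points of the domain on the lines are numbered so that the numbers
   increase along each line; [al l] and [be l] are the ends of the chord of [l].
   A configuration on the lines of [A] gives the junk value [(al l, be l)] to
   the other lines. *)
Definition config := {ffun I -> 'I_N * 'I_N}.

Implicit Types (A : {set I}) (c : config) (l m b t s : I).

Definition lo c l : nat := (c l).1.
Definition hi c l : nat := (c l).2.

Definition inside c m (z : nat) := inc m z && (lo c m < z < hi c m).

Definition blocked A c l z := [exists m in A, (m != l) && inside c m z].

Definition is_segment c l :=
  [&& inc l (lo c l), inc l (hi c l) & lo c l < hi c l].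

Definition noncrossing A c :=
  [forall l in A, forall m in A, (l != m) ==>
    [forall z : 'I_N, ~~ (inside c l z && inside c m z)]].

Definition valid A c :=
  [&& [forall l in A, [&& is_segment c l,
         (lo c l == al l) || blocked A c l (lo c l) &
         (hi c l == be l) || blocked A c l (hi c l)]],
      noncrossing A c &
      [forall l, (l \notin A) ==> (c l == (al l, be l))]].

Lemma noncrossingP A c :
  reflect (forall l m z, l \in A -> m \in A -> l != m ->
             inside c l z -> inside c m z -> False) (noncrossing A c).
Proof.
apply: (iffP 'forall_in_forall_inP) => [H l m z lA mA lm il im|H l lA m mA].
  have zN : z < N by case/andP: il => _ /andP[_ /ltn_trans]; apply; exact: ltn_ord.
  by have /implyP/(_ lm)/forallP/(_ (Ordinal zN)) := H l lA m mA; rewrite /= il im.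
by apply/implyP => lm; apply/forallP => z; apply/negP => /andP[]; exact: H.
Qed.

Lemma insideP c m z :
  reflect [/\ inc m z, lo c m < z & z < hi c m] (inside c m z).
Proof. by apply: (iffP and3P). Qed.

Lemma blockedP A c l z :
  reflect (exists m, [/\ m \in A, m != l & inside c m z]) (blocked A c l z).
Proof.
apply: (iffP exists_inP) => [[m mA /andP[]]|[m [mA ml im]]]; first by exists m.
by exists m; rewrite // ml.
Qed.

Lemma validP A c :
  reflect [/\ forall l, l \in A -> [/\ inc l (lo c l), inc l (hi c l) & lo c l < hi c l],
     forall l, l \in A -> lo c l = al l \/ blocked A c l (lo c l),
     forall l, l \in A -> hi c l = be l \/ blocked A c l (hi c l),
     forall l m z, l \in A -> m \in A -> l != m ->
             inside c l z -> inside c m z -> False &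
     forall l, l \notin A -> c l = (al l, be l)] (valid A c).
Proof.
apply: (iffP and3P).
  move=> [/forall_inP H /noncrossingP X /forallP Y]; split => //.
  - by move=> l /H/and3P[/and3P[]].
  - by move=> l /H/and3P[_ /orP[/eqP|]]; [left|right].
  - by move=> l /H/and3P[_ _ /orP[/eqP|]]; [left|right].
  - by move=> l lA; apply/eqP; move: (Y l); rewrite lA.
move=> [H1 H2 H3 H4 H5]; split; last 2 first.
- exact/noncrossingP.
- by apply/forallP => l; apply/implyP => /H5 ->.
apply/forall_inP => l lA; apply/and3P; split.
- exact/and3P/H1.
- by case: (H2 l lA) => [->|->]; rewrite ?eqxx ?orbT.
- by case: (H3 l lA) => [->|->]; rewrite ?eqxx ?orbT.
Qed.

(** * Prolonging the ends left free by a removed segment *)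

Definition enlargesb b c c' A := [forall l in A,
  [&& lo c' l <= lo c l, hi c l <= hi c' l,
      (lo c' l < lo c l) ==> inc b (lo c l) & (hi c l < hi c' l) ==> inc b (hi c l)]].

Definition enlarges b c c' A := forall l, l \in A ->
  [/\ lo c' l <= lo c l, hi c l <= hi c' l,
      lo c' l < lo c l -> inc b (lo c l) & hi c l < hi c' l -> inc b (hi c l)].

Lemma enlargesP b c c' A : reflect (enlarges b c c' A) (enlargesb b c c' A).
Proof.
apply: (iffP forall_inP) => H l /H.
  by case/and4P => h1 h2 /implyP h3 /implyP h4.
by case=> h1 h2 h3 h4; apply/and4P; split=> //; exact/implyP.
Qed.

(* As [valid], but ends may also dangle on the line [b], whose segment is gone. *)
Definition dangling_valid A b c :=
  [/\ forall l, l \in A -> is_segment c l,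
      forall l, l \in A -> [|| lo c l == al l, blocked A c l (lo c l) | inc b (lo c l)],
      forall l, l \in A -> [|| hi c l == be l, blocked A c l (hi c l) | inc b (hi c l)],
      forall l m z, l \in A -> m \in A -> l != m ->
             inside c l z -> inside c m z -> False &
      forall l, l \notin A -> c l = (al l, be l)].

Lemma blocked_mono A c c' l z :
  (forall m, m \in A -> lo c' m <= lo c m /\ hi c m <= hi c' m) ->
  blocked A c l z -> blocked A c' l z.
Proof.
move=> H /blockedP[m [mA ml /insideP[i1 i2 i3]]]; apply/blockedP.
exists m; split=> //; apply/insideP; have [h1 h2] := H m mA; split=> //; natlia.
Qed.

Definition upd c l (x : 'I_N * 'I_N) : config := [ffun t => if t == l then x else c t].

Lemma upd_same c l x : upd c l x l = x.
Proof. by rewrite ffunE eqxx. Qed.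

Lemma upd_other c l x t : t != l -> upd c l x t = c t.
Proof. by rewrite ffunE => /negbTE ->. Qed.

(** Common core of the prolongations to the right and to the left. Enlarging a segment keeps every
    block, so only the free passage of the new part has to be checked. *)
Lemma enlarge_one A b c l (x y : 'I_N) : b \notin A -> l \in A -> dangling_valid A b c ->
  x <= lo c l -> hi c l <= y -> inc l x -> inc l y ->
  (x = lo c l :> nat) \/ inc b (lo c l) /\ (x = al l \/ blocked A c l x) ->
  (y = hi c l :> nat) \/ inc b (hi c l) /\ (y = be l \/ blocked A c l y) ->
  (forall m z, m \in A -> m != l -> inc l z -> x < z < y -> inside c m z -> False) ->
  dangling_valid A b (upd c l (x, y)) /\ enlarges b c (upd c l (x, y)) A.
Proof.
move=> bA lA [H1 H2 H3 H4 H5] xl hy ix iy Hx Hy Hm.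
set c' := upd c l (x, y).
have lo' t : lo c' t = if t == l then x : nat else lo c t.
  by rewrite /lo /c' ffunE; case: ifP.
have hi' t : hi c' t = if t == l then y : nat else hi c t.
  by rewrite /hi /c' ffunE; case: ifP.
have mono m : m \in A -> lo c' m <= lo c m /\ hi c m <= hi c' m.
  by rewrite lo' hi'; case: eqP => [->|].
have bmono := @blocked_mono A c c' _ _ mono.
split; first split.
- move=> t tA; rewrite /is_segment lo' hi'; case: eqP => [->|_]; last exact: H1.
  by rewrite ix iy /=; have /and3P[_ _] := H1 l lA; natlia.
- move=> t tA; rewrite lo'; have := H2 t tA; case: (t =P l) => [->|_].
    case: Hx => [->|[_ [->|/bmono->]]]; rewrite ?eqxx ?orbT //.
    by move=> /or3P[->|/bmono->|->]; rewrite ?orbT.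
  by move=> /or3P[->|/bmono->|->]; rewrite ?orbT.
- move=> t tA; rewrite hi'; have := H3 t tA; case: (t =P l) => [->|_].
    case: Hy => [->|[_ [->|/bmono->]]]; rewrite ?eqxx ?orbT //.
    by move=> /or3P[->|/bmono->|->]; rewrite ?orbT.
  by move=> /or3P[->|/bmono->|->]; rewrite ?orbT.
- have key m z : m \in A -> m != l -> inside c' l z -> inside c' m z -> False.
    move=> mA ml /insideP[i1]; rewrite lo' hi' eqxx => i2 i3 im.
    apply: (Hm m z) => //; first by rewrite i2 i3.
    by move: im; rewrite /inside lo' hi' (negbTE ml).
  move=> t m z tA mA tm it im.
  have [tl|tl] := eqVneq t l.
    by apply: (key m z) => //; rewrite -?tl // eq_sym.
  have [ml|ml] := eqVneq m l.
    by apply: (key t z) => //; rewrite -ml.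
  apply: (H4 t m z) => //.
    by move: it; rewrite /inside lo' hi' (negbTE tl).
  by move: im; rewrite /inside lo' hi' (negbTE ml).
- by move=> t tA; rewrite upd_other ?H5 //; apply: contraNneq tA => ->.
move=> t tA; rewrite lo' hi'; case: eqP => [->|_]; last by split; natlia.
split=> //.
  by case: Hx => [->|[]] //; rewrite ltnn.
by case: Hy => [->|[]] //; rewrite ltnn.
Qed.

Lemma enlarges_trans A b c c' c'' : b \notin A ->
  dangling_valid A b c -> dangling_valid A b c' ->
  enlarges b c c' A -> enlarges b c' c'' A -> enlarges b c c'' A.
Proof.
move=> bA [H1 _ _ _ _] [H1' _ _ _ _] E E' l lA.
have [e1 e2 e3 e4] := E l lA; have [f1 f2 f3 f4] := E' l lA.
split; try natlia.
  move=> lt; have [lt'|ge] := ltnP (lo c' l) (lo c l); first exact: e3.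
  by have eq : lo c' l = lo c l by [natlia]; rewrite -eq; apply: f3; natlia.
move=> lt; have [lt'|ge] := ltnP (hi c l) (hi c' l); first exact: e4.
by have eq : hi c' l = hi c l by [natlia]; rewrite -eq; apply: f4; natlia.
Qed.

Lemma first_obstacle A c l q : q < be l -> exists y : 'I_N,
  [/\ q < y, inc l y,
      y = be l \/ exists m, [/\ m \in A, m != l, inc m y & lo c m <= y <= hi c m] &
      forall m z, m \in A -> m != l -> inc l z -> q < z < y -> inside c m z -> False].
Proof.
move=> qb.
pose P z := (z < N) && (q < z) && inc l z && ((z == be l) ||
  [exists m in A, [&& m != l, inc m z & lo c m <= z <= hi c m]]).
have exP : exists z, P z.
  by exists (be l); rewrite /P ltn_ord qb inc_be eqxx.
case: (ex_minnP exP) => y /andP[/andP[/andP[yN qy] iy] Hy] ymin.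
exists (Ordinal yN); split=> //=.
  case/orP: Hy => [/eqP e|/exists_inP[m mA /and3P[]]]; first by left; apply: val_inj.
  by right; exists m.
move=> m z mA ml iz /andP[qz zy] /insideP[imz lz zh].
suff : y <= z by natlia.
apply: ymin; rewrite /P qz iz (ltn_trans zy yN) /=; apply/orP; right.
by apply/exists_inP; exists m => //; rewrite ml imz /=; natlia.
Qed.

Lemma last_obstacle A c l q : al l < q -> exists y : 'I_N,
  [/\ y < q, inc l y,
      y = al l \/ exists m, [/\ m \in A, m != l, inc m y & lo c m <= y <= hi c m] &
      forall m z, m \in A -> m != l -> inc l z -> y < z < q -> inside c m z -> False].
Proof.
move=> qb.
pose P z := (z < q) && inc l z && ((z == al l) ||
  [exists m in A, [&& m != l, inc m z & lo c m <= z <= hi c m]]).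
have exP : exists z, P z.
  by exists (al l); rewrite /P qb inc_al eqxx.
have boundP z : P z -> z <= N.
  case/andP => /andP[zq /inc_bounds h] _; have := ltn_ord (be l); natlia.
case: (ex_maxnP exP boundP) => y /andP[/andP[qy iy] Hy] ymax.
have yN : y < N by have := inc_bounds iy; have := ltn_ord (be l); natlia.
exists (Ordinal yN); split=> //=.
  case/orP: Hy => [/eqP e|/exists_inP[m mA /and3P[]]]; first by left; apply: val_inj.
  by right; exists m.
move=> m z mA ml iz /andP[qz zy] /insideP[imz lz zh].
suff : z <= y by natlia.
apply: ymax; rewrite /P zy iz /=; apply/orP; right.
by apply/exists_inP; exists m => //; rewrite ml imz /=; natlia.
Qed.

(* If [y] is an end of the segment that it hits, then this end is blocked, and
   the blocking segment has [y] in its interior. *)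
Lemma obstacle_blocks A b c l (y : nat) : dangling_valid A b c -> l \in A ->
  inc l y -> ~~ inside c l y -> ~~ inc b y ->
  (exists m, [/\ m \in A, m != l, inc m y & lo c m <= y <= hi c m]) ->
  [\/ y = al l, y = be l | blocked A c l y].
Proof.
move=> [H1 H2 H3 _ _] lA ily nil nib [m [mA ml imy bnd]].
have in_blocked : blocked A c m y -> blocked A c l y.
  case/blockedP => m' [m'A m'm im']; apply/blockedP; exists m'; split=> //.
  by apply: contraNneq nil => <-.
have extr : y = al m \/ y = be m -> [\/ y = al l, y = be l | blocked A c l y].
  by case/(extreme_compat ily imy) => e; [constructor 1|constructor 2].
have [e|nlo] := eqVneq y (lo c m).
  case/or3P: (H2 m mA) => [/eqP e'|Hb|].
  - by apply: extr; left; rewrite e e'.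
  - by constructor 3; apply: in_blocked; rewrite e.
  - by rewrite -e (negbTE nib).
have [e|nhi] := eqVneq y (hi c m).
  case/or3P: (H3 m mA) => [/eqP e'|Hb|].
  - by apply: extr; right; rewrite e e'.
  - by constructor 3; apply: in_blocked; rewrite e.
  - by rewrite -e (negbTE nib).
constructor 3; apply/blockedP; exists m; split=> //; apply/insideP; split=> //; natlia.
Qed.

(** Termination measure of [extend_all]: every prolongation increases it, and it is bounded. *)
Definition total_length A c := \sum_(l in A) (hi c l - lo c l).

Lemma total_length_bound A c : total_length A c <= #|A| * N.
Proof.
rewrite -sum_nat_const; apply: leq_sum => l _.
by have := ltn_ord (c l).2; rewrite /hi; natlia.
Qed.

Lemma total_length_upd A c l (x y : 'I_N) : l \in A -> lo c l < hi c l ->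
  x <= lo c l -> hi c l <= y -> (x < lo c l) || (hi c l < y) ->
  total_length A c < total_length A (upd c l (x, y)).
Proof.
move=> lA lt h1 h2 h3; rewrite /total_length !(bigD1 l lA) /=.
rewrite [X in _ < _ + X](eq_bigr (fun t => hi c t - lo c t)).
  by rewrite ltn_add2r /lo /hi upd_same /=; move: lt h1 h2 h3; rewrite /lo /hi; natlia.
by move=> t /andP[_ tl]; rewrite /lo /hi upd_other.
Qed.

Lemma extend_hi A b c l : b \notin A -> l \in A -> dangling_valid A b c ->
  inc b (hi c l) -> hi c l != be l -> ~~ blocked A c l (hi c l) ->
  exists2 c', dangling_valid A b c' /\ enlarges b c c' A &
    total_length A c < total_length A c'.
Proof.
move=> bA lA V ibq nbe nbl; have [H1 H2 H3 H4 H5] := V.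
have /and3P[ilo ihi lt] := H1 l lA.
have qb : hi c l < be l by have := inc_bounds ihi; natlia.
have bl : b != l by apply: contraNneq bA => ->.
have [y [qy iy Hy Hfree]] := first_obstacle A c qb.
(* The line [l] meets [b] at the old end already, hence not again at [y]: the new end cannot dangle
   on [b]. *)
have niby : ~~ inc b y.
  by apply/negP => iby; have := meet_uniq bl ibq ihi iby iy; natlia.
have yend : y = be l \/ blocked A c l y.
  case: Hy => [|ex]; first by left.
  case: (@obstacle_blocks A b c l y) => //.
  - by apply/insideP => -[]; natlia.
  - by move=> e; have := inc_bounds ilo; natlia.
  - by move=> e; left; apply: val_inj.
  - by right.
exists (upd c l ((c l).1, y)).
apply: enlarge_one => //; first exact: ltnW.
- by left.
- by right.
(* The way is free before the old end by noncrossing, at the old end because it is not blocked, and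
   beyond it by the choice of [y]. *)
- move=> m z mA ml iz /andP[z1 z2] imz.
  case: (ltngtP z (hi c l)) => zh.
  + by apply: (H4 l m z) => //; rewrite 1?eq_sym //; apply/insideP.
  + by apply: (Hfree m z) => //; rewrite zh z2.
  + by move/negP: nbl; apply; apply/blockedP; exists m; rewrite -zh.
by apply: total_length_upd => //; [exact: ltnW|rewrite qy orbT].
Qed.

Lemma extend_lo A b c l : b \notin A -> l \in A -> dangling_valid A b c ->
  inc b (lo c l) -> lo c l != al l -> ~~ blocked A c l (lo c l) ->
  exists2 c', dangling_valid A b c' /\ enlarges b c c' A &
    total_length A c < total_length A c'.
Proof.
move=> bA lA V ibq nbe nbl; have [H1 H2 H3 H4 H5] := V.
have /and3P[ilo ihi lt] := H1 l lA.
have qb : al l < lo c l by have := inc_bounds ilo; natlia.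
have bl : b != l by apply: contraNneq bA => ->.
have [y [qy iy Hy Hfree]] := last_obstacle A c qb.
have niby : ~~ inc b y.
  by apply/negP => iby; have := meet_uniq bl ibq ilo iby iy; natlia.
have yend : y = al l \/ blocked A c l y.
  case: Hy => [|ex]; first by left.
  case: (@obstacle_blocks A b c l y) => //.
  - by apply/insideP => -[]; natlia.
  - by move=> e; left; apply: val_inj.
  - by move=> e; have := inc_bounds ihi; natlia.
  - by right.
exists (upd c l (y, (c l).2)).
apply: enlarge_one => //; first exact: ltnW.
- by right.
- by left.
- move=> m z mA ml iz /andP[z1 z2] imz.
  case: (ltngtP z (lo c l)) => zh.
  + by apply: (Hfree m z) => //; rewrite zh z1.
  + by apply: (H4 l m z) => //; rewrite 1?eq_sym //; apply/insideP.
  + by move/negP: nbl; apply; apply/blockedP; exists m; rewrite -zh.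
by apply: total_length_upd => //; [exact: ltnW|rewrite qy].
Qed.

(** The ends are prolonged one at a time, since a prolonged segment may become the blocker of
    another. The outcome may depend on the order; only its existence is claimed. *)
Lemma extend_all A b c : b \notin A -> dangling_valid A b c ->
  exists2 c', valid A c' & enlarges b c c' A.
Proof.
move=> bA; have [n] := ubnP (#|A| * N - total_length A c).
elim: n c => // n IHn c len V; have [H1 H2 H3 H4 H5] := V.
have step : (exists2 c1, dangling_valid A b c1 /\ enlarges b c c1 A &
    total_length A c < total_length A c1) -> exists2 c', valid A c' & enlarges b c c' A.
  case=> c1 [V1 E1] lt; have [|c' V' E'] := IHn c1 _ V1.
    by have := total_length_bound A c1; natlia.
  by exists c' => //; apply: enlarges_trans E1 E'.
have [/existsP[l /and3P[lA ne nb]]|/existsPn Hlo] :=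
    boolP [exists l, [&& l \in A, lo c l != al l & ~~ blocked A c l (lo c l)]].
  apply: step; apply: (extend_lo bA lA V) => //.
  by have := H2 l lA; rewrite (negbTE ne) (negbTE nb).
have [/existsP[l /and3P[lA ne nb]]|/existsPn Hhi] :=
    boolP [exists l, [&& l \in A, hi c l != be l & ~~ blocked A c l (hi c l)]].
  apply: step; apply: (extend_hi bA lA V) => //.
  by have := H3 l lA; rewrite (negbTE ne) (negbTE nb).
exists c.
  apply/validP; split=> //; first by move=> l /H1/and3P[].
    move=> l lA; have := Hlo l; rewrite lA /= negb_and !negbK => /orP[/eqP|]; by [left|right].
  move=> l lA; have := Hhi l; rewrite lA /= negb_and !negbK => /orP[/eqP|]; by [left|right].
by move=> l _; split; rewrite ?ltnn.
Qed.

(* The ends that were blocked by [b] are prolonged up to the next obstacle. *)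
Lemma remove_exists A b c : b \in A -> valid A c ->
  exists2 c', valid (A :\ b) c' & enlarges b c c' (A :\ b).
Proof.
move=> bA /validP[V1 V2 V3 V4 V5].
have sub l : l \in A :\ b -> l \in A by case/setD1P.
have other l : l \in A :\ b -> upd c b (al b, be b) l = c l.
  by case/setD1P => lb _; rewrite upd_other.
have blk l z : blocked A c l z -> blocked (A :\ b) (upd c b (al b, be b)) l z || inc b z.
  case/blockedP => m [mA ml im]; have [e|mb] := eqVneq m b.
    by case/insideP: im; rewrite e => ->; rewrite orbT.
  apply/orP; left; apply/blockedP; exists m; split=> //; first exact/setD1P.
  by move: im; rewrite /inside /lo /hi upd_other.
have [||c' Vc' E] := @extend_all (A :\ b) b (upd c b (al b, be b)).
- by rewrite setD11.
- split.
  + by move=> l lA; rewrite /is_segment /lo /hi other //; apply/and3P/V1/sub.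
  + move=> l lA; rewrite /lo other // -/(lo c l).
    by case: (V2 l (sub l lA)) => [->|/blk]; rewrite ?eqxx // => ->; rewrite orbT.
  + move=> l lA; rewrite /hi other // -/(hi c l).
    by case: (V3 l (sub l lA)) => [->|/blk]; rewrite ?eqxx // => ->; rewrite orbT.
  + move=> l m z lA mA; rewrite /inside /lo /hi !other //.
    by apply: V4; exact: sub.
  + move=> l; rewrite !inE negb_and negbK; have [->|lb] /= := eqVneq l b.
      by rewrite upd_same.
    by rewrite upd_other // => /V5.
exists c' => // l lA; have := E l lA; by rewrite /lo /hi other.
Qed.

(** * Removing and reinserting a pair of segments *)

(** Any admissible prolongation will do, provided it is fixed once and for all: the decoding never
    prolongs anything, it uses only that the ends that moved were on [b]. The default [c] is never
    reached for valid [c] and [b] in [A]. *)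
Definition remove A c b : config :=
  odflt c [pick c' | valid (A :\ b) c' && enlargesb b c c' (A :\ b)].

Lemma removeP A b c : b \in A -> valid A c ->
  valid (A :\ b) (remove A c b) /\ enlarges b c (remove A c b) (A :\ b).
Proof.
move=> bA V; rewrite /remove; case: pickP => [c' /andP[V' /enlargesP] //|H].
have [c' V' E'] := remove_exists bA V.
by have := H c'; rewrite V' /=; move/negbT/negP; case; exact/enlargesP.
Qed.

Definition blocks_end c s t := (t != s) && (inside c s (lo c t) || inside c s (hi c t)).

Definition blocked_set A c s := [set t in A | blocks_end c s t].

Section Reinsert.

Variables (A : {set I}) (b : I) (c' : config).
Hypothesis bA : b \in A.
Hypothesis V' : valid (A :\ b) c'.

(* Only the ends that were blocked by [b] have moved. *)
Lemma enlarged_lo c t : valid A c -> enlarges b c c' (A :\ b) -> t \in A :\ b ->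
  lo c' t != lo c t -> inside c b (lo c t).
Proof.
move=> /validP[V1 V2 V3 V4 V5] E tA ne; have [e1 e2 e3 e4] := E t tA.
have /setD1P[tb tA'] := tA; have [i1 i2 i3] := V1 t tA'.
have lt : lo c' t < lo c t by natlia.
case: (V2 t tA') => [e|/blockedP[m [mA mt im]]].
  have /validP[/(_ t tA)[/inc_bounds]] := V'; natlia.
have [<- //|mb] := eqVneq m b.
have mA' : m \in A :\ b by apply/setD1P.
have [f1 f2 _ _] := E m mA'.
(* A blocker [m] other than [b] still contains this point, so the prolonged [t] would cross it. *)
have /validP[_ _ _ X _] := V'; case: (X t m (lo c t)) => //; first by rewrite eq_sym.
  by apply/insideP; split=> //; natlia.
by case/insideP: im => j1 j2 j3; apply/insideP; split=> //; natlia.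
Qed.

Lemma enlarged_hi c t : valid A c -> enlarges b c c' (A :\ b) -> t \in A :\ b ->
  hi c' t != hi c t -> inside c b (hi c t).
Proof.
move=> /validP[V1 V2 V3 V4 V5] E tA ne; have [e1 e2 e3 e4] := E t tA.
have /setD1P[tb tA'] := tA; have [i1 i2 i3] := V1 t tA'.
have lt : hi c t < hi c' t by natlia.
case: (V3 t tA') => [e|/blockedP[m [mA mt im]]].
  have /validP[/(_ t tA)[_ /inc_bounds]] := V'; natlia.
have [<- //|mb] := eqVneq m b.
have mA' : m \in A :\ b by apply/setD1P.
have [f1 f2 _ _] := E m mA'.
have /validP[_ _ _ X _] := V'; case: (X t m (hi c t)) => //; first by rewrite eq_sym.
  by apply/insideP; split=> //; natlia.
by case/insideP: im => j1 j2 j3; apply/insideP; split=> //; natlia.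
Qed.

Definition touches t (z : nat) := inc t z && (lo c' t <= z <= hi c' t).

Definition crossing x y := [set t in A :\ b | [exists z : 'I_N,
  [&& inc b z, x < z < y & touches t z]]].

(** A segment that meets the open segment of [b] after the removal was stopped by [b]: otherwise
    both its ends are unmoved and off [b], and it would have crossed [b] before. Hence the lightness
    of [b] bounds all that has to be recorded. *)
Lemma crossing_sub c (x y : nat) : valid A c -> enlarges b c c' (A :\ b) ->
  lo c b <= x -> y <= hi c b -> crossing x y \subset blocked_set A c b.
Proof.
move=> V E lx yh; apply/subsetP => t; rewrite !inE => /andP[/andP[tb tA]].
have tA' : t \in A :\ b by apply/setD1P.
case/existsP => z /and3P[ib /andP[xz zy] /andP[it /andP[tz zt]]].
rewrite tA /blocks_end tb /=.
have ibz : inside c b z by apply/insideP; split=> //; natlia.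
have [ilo|nlo] := boolP (inside c b (lo c t)) => //=.
have [ihi|nhi] := boolP (inside c b (hi c t)) => //=.
have elo : lo c' t = lo c t by apply/eqP; apply: contraR nlo; exact: enlarged_lo.
have ehi : hi c' t = hi c t by apply/eqP; apply: contraR nhi; exact: enlarged_hi.
have /validP[_ _ _ X _] := V; case: (X t b z) => //; apply/insideP; split=> //.
  by rewrite ltn_neqAle -elo tz andbT; apply: contraNneq nlo; rewrite elo => ->.
by rewrite ltn_neqAle -ehi zt andbT; apply: contraNneq nhi; rewrite -ehi => <-.
Qed.

(** At most one end of [t] was on [b], so three values suffice: the lower end, the upper end, or
    neither is to be cut back. *)
Definition cut c t : 'I_3 :=
  if lo c' t != lo c t then inord 1 else if hi c' t != hi c t then inord 2 else ord0.

(** The enumeration depends on [c] only through the ends of [b], which are decoded beforehand.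
    Entries past its end carry the junk value of the default [b]. *)
Definition cut_vector n c : {ffun 'I_n -> 'I_3} :=
  [ffun i : 'I_n => cut c (nth b (enum (crossing (lo c b) (hi c b))) i)].

Lemma mem_crossing c t : valid A c -> enlarges b c c' (A :\ b) -> t \in A :\ b ->
  t \notin crossing (lo c b) (hi c b) -> c t = c' t.
Proof.
move=> V E tA; rewrite inE tA /= => /existsPn H.
have [e1 e2 _ _] := E t tA; have /validP[V1 _ _ _ _] := V.
have /setD1P[tb tA'] := tA; have [i1 i2 i3] := V1 t tA'.
rewrite [LHS]surjective_pairing [RHS]surjective_pairing; congr pair; apply: val_inj.
  apply/eqP; rewrite eq_sym -/(lo c' t) -/(lo c t); apply/negPn/negP => ne.
  have /insideP[j1 j2 j3] := enlarged_lo V E tA ne.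
  by move: (H (c t).1) => /negP; case; rewrite -/(lo c t) j1 j2 j3 /touches i1 e1 /=; natlia.
apply/eqP; rewrite eq_sym -/(hi c' t) -/(hi c t); apply/negPn/negP => ne.
have /insideP[j1 j2 j3] := enlarged_hi V E tA ne.
by move: (H (c t).2) => /negP; case; rewrite -/(hi c t) j1 j2 j3 /touches i2 e2 /=; natlia.
Qed.

(** A cut end is the unique common point of [t] and [b], and an uncut end is unchanged, so it is
    enough to know which end was cut. *)
Lemma cut_inj c1 c2 t : valid A c1 -> valid A c2 ->
  enlarges b c1 c' (A :\ b) -> enlarges b c2 c' (A :\ b) -> t \in A :\ b ->
  cut c1 t = cut c2 t -> c1 t = c2 t.
Proof.
move=> V1 V2 E1 E2 tA; have /setD1P[tb tA'] := tA.
have /validP[/(_ t tA')[i1 j1 lt1] _ _ _ _] := V1.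
have /validP[/(_ t tA')[i2 j2 lt2] _ _ _ _] := V2.
suff main : cut c1 t = cut c2 t -> lo c1 t = lo c2 t /\ hi c1 t = hi c2 t.
  move/main => [e1 e2]; rewrite [LHS]surjective_pairing [RHS]surjective_pairing.
  by congr pair; apply: val_inj.
have both c : inc t (lo c t) -> inc t (hi c t) -> lo c t < hi c t ->
    valid A c -> enlarges b c c' (A :\ b) ->
    lo c' t != lo c t -> hi c' t == hi c t.
  move=> i j lt V E /(enlarged_lo V E tA)/insideP[il _ _].
  apply/negPn/negP => /(enlarged_hi V E tA)/insideP[ih _ _].
  by have := meet_uniq tb i il j ih; natlia.
have := both c1 i1 j1 lt1 V1 E1; have := both c2 i2 j2 lt2 V2 E2; rewrite /cut.
have [l1|l1] := eqVneq (lo c' t) (lo c1 t); have [l2|l2] := eqVneq (lo c' t) (lo c2 t) => /=.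
- have [h1|h1] := eqVneq (hi c' t) (hi c1 t); have [h2|h2] := eqVneq (hi c' t) (hi c2 t) => /=.
  + by rewrite -l1 -l2 -h1 -h2.
  + by move=> _ _ /(congr1 val); rewrite /= inordK.
  + by move=> _ _ /(congr1 val); rewrite /= inordK.
  + move=> _ _ _; split; first by rewrite -l1.
    have /insideP[k1 _ _] := enlarged_hi V1 E1 tA h1.
    have /insideP[k2 _ _] := enlarged_hi V2 E2 tA h2.
    exact: (meet_uniq tb j1 k1 j2 k2).
- by move=> _ _; case: ifP => _ /(congr1 val); rewrite /= !inordK.
- by move=> _ _; case: ifP => _ /(congr1 val); rewrite /= !inordK.
- move=> /(_ isT)/eqP h2 /(_ isT)/eqP h1 _; split; last by rewrite -h1.
  have /insideP[k1 _ _] := enlarged_lo V1 E1 tA l1.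
  have /insideP[k2 _ _] := enlarged_lo V2 E2 tA l2.
  exact: (meet_uniq tb i1 k1 i2 k2).
Qed.

Lemma reinsert_inj n c1 c2 : valid A c1 -> valid A c2 ->
  enlarges b c1 c' (A :\ b) -> enlarges b c2 c' (A :\ b) ->
  lo c1 b = lo c2 b -> hi c1 b = hi c2 b -> #|blocked_set A c1 b| <= n ->
  cut_vector n c1 = cut_vector n c2 -> c1 = c2.
Proof.
move=> V1 V2 E1 E2 el eh dn ek.
have /validP[_ _ _ _ D1] := V1; have /validP[_ _ _ _ D2] := V2.
apply/ffunP => t; have [tA|tA] := boolP (t \in A); last by rewrite D1 ?D2.
have [->|tb] := eqVneq t b.
  rewrite [LHS]surjective_pairing [RHS]surjective_pairing.
  by congr pair; apply: val_inj.
have tA' : t \in A :\ b by apply/setD1P.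
have [tX|tX] := boolP (t \in crossing (lo c1 b) (hi c1 b)); last first.
  rewrite (mem_crossing V1 E1) // (mem_crossing V2 E2) //.
  by rewrite -el -eh.
apply: cut_inj => //.
have tX' : t \in enum (crossing (lo c1 b) (hi c1 b)) by rewrite mem_enum.
have ltn : index t (enum (crossing (lo c1 b) (hi c1 b))) < n.
  apply: leq_trans dn; apply: leq_trans (subset_leq_card (crossing_sub V1 E1 (leqnn _) (leqnn _))).
  by rewrite cardE index_mem.
have := congr1 (fun f : {ffun 'I_n -> 'I_3} => f (Ordinal ltn)) ek.
by rewrite !ffunE /= -el -eh nth_index.
Qed.

Definition hits z := [exists t in A :\ b, touches t z].

(** An end of [b] is a chord end or a hit point, so it is located by the number of hit points
    between it and a known point. Points are counted, not segments, as several segments may touch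
    [b] at one point. *)
Definition hit_count x y := #|[set z : 'I_N | [&& inc b z, x < z < y & hits z]]|.

Lemma hit_count_bound c (x y : nat) : valid A c -> enlarges b c c' (A :\ b) ->
  lo c b <= x -> y <= hi c b -> hit_count x y <= #|blocked_set A c b|.
Proof.
move=> V E lx yh; apply: leq_trans (subset_leq_card (crossing_sub V E lx yh)).
pose f (z : 'I_N) := odflt b [pick t in A :\ b | touches t z].
have fP z : z \in [set z : 'I_N | [&& inc b z, x < z < y & hits z]] ->
    [/\ inc b z, x < z < y, f z \in A :\ b & touches (f z) z].
  rewrite inE => /and3P[-> -> /exists_inP[t tA tz]]; rewrite /f; case: pickP.
    by move=> t' /andP[].
  by move/(_ t); rewrite tA tz.
rewrite /hit_count -(card_in_imset (f := f)).
  apply: subset_leq_card; apply/subsetP => _ /imsetP[z /fP[ib xy fA tz] ->].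
  by rewrite inE fA /=; apply/existsP; exists z; apply/and3P.
move=> z1 z2 /fP[ib1 _ fA1 /andP[it1 _]] /fP[ib2 _ _ /andP[it2 _]] e.
apply: val_inj; move: fA1 => /setD1P[fb _]; apply: (meet_uniq fb it1 ib1) => //.
by rewrite e.
Qed.

Lemma hits_lo c : valid A c -> enlarges b c c' (A :\ b) -> lo c b = al b \/ hits (lo c b).
Proof.
move=> V E; have /validP[_ V2 _ _ _] := V; case: (V2 b bA) => [|/blockedP[m [mA mb im]]].
  by left.
have mA' : m \in A :\ b by apply/setD1P.
right; apply/exists_inP; exists m => //; case/insideP: im => i1 i2 i3.
by rewrite /touches i1 /=; have [] := E m mA'; natlia.
Qed.

Lemma hits_hi c : valid A c -> enlarges b c c' (A :\ b) -> hi c b = be b \/ hits (hi c b).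
Proof.
move=> V E; have /validP[_ _ V2 _ _] := V; case: (V2 b bA) => [|/blockedP[m [mA mb im]]].
  by left.
have mA' : m \in A :\ b by apply/setD1P.
right; apply/exists_inP; exists m => //; case/insideP: im => i1 i2 i3.
by rewrite /touches i1 /=; have [] := E m mA'; natlia.
Qed.

(** Of two distinct candidates, the one closer to [p] is not the chord end, hence is a hit point; it
    is counted from the farther one but not from itself. *)
Lemma hit_count_lo_inj (x1 x2 : 'I_N) p : inc b x1 -> inc b x2 ->
  x1 = al b :> nat \/ hits x1 -> x2 = al b :> nat \/ hits x2 -> x1 < p -> x2 < p ->
  hit_count x1 p = hit_count x2 p -> x1 = x2.
Proof.
wlog le : x1 x2 / x1 <= x2 => [W i1 i2 h1 h2 l1 l2 e|].
  case/orP: (leq_total x1 x2) => le; first exact: W.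
  by apply/esym/W.
move=> i1 i2 h1 h2 l1 l2 e; apply: val_inj; apply/eqP; rewrite eqn_leq le /= leqNgt.
apply/negP => lt; have h : hits x2 by case: h2 => // e2; have := inc_bounds i1; natlia.
suff : hit_count x2 p < hit_count x1 p by rewrite e ltnn.
apply: proper_card; apply/properP; split.
  apply/subsetP => z; rewrite !inE => /and3P[-> /andP[z1 z2] ->]; rewrite z2 /= andbT; natlia.
by exists x2; rewrite !inE ?i2 ?lt ?l2 ?h // ltnn andbF.
Qed.

Lemma hit_count_hi_inj (x1 x2 : 'I_N) p : inc b x1 -> inc b x2 ->
  x1 = be b :> nat \/ hits x1 -> x2 = be b :> nat \/ hits x2 -> p < x1 -> p < x2 ->
  hit_count p x1 = hit_count p x2 -> x1 = x2.
Proof.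
wlog le : x1 x2 / x2 <= x1 => [W i1 i2 h1 h2 l1 l2 e|].
  case/orP: (leq_total x2 x1) => le; first exact: W.
  by apply/esym/W.
move=> i1 i2 h1 h2 l1 l2 e; apply: val_inj; apply/eqP; rewrite eq_sym eqn_leq le /= leqNgt.
apply/negP => lt; have h : hits x2 by case: h2 => // e2; have := inc_bounds i1; natlia.
suff : hit_count p x2 < hit_count p x1 by rewrite e ltnn.
apply: proper_card; apply/properP; split.
  apply/subsetP => z; rewrite !inE => /and3P[-> /andP[z1 z2] ->]; rewrite z1 /= andbT; natlia.
by exists x2; rewrite !inE ?i2 ?lt ?l2 ?h // ltnn !andbF.
Qed.

End Reinsert.

Section RemovePair.

Variables (A : {set I}) (s b : I) (D : nat).
Hypotheses (sA : s \in A) (bA : b \in A) (sb : s != b).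

Definition removable_pair c := [&& valid A c, inside c b (lo c s),
  #|blocked_set A c s| <= D & #|blocked_set A c b| <= D].

Let A1 := A :\ s.
Let c1 c := remove A c s.
Let c2 c := remove A1 (c1 c) b.

Let bA1 : b \in A1. Proof. by apply/setD1P; rewrite eq_sym. Qed.

Let removable_spec c : removable_pair c ->
  [/\ valid A c, valid A1 (c1 c), valid (A1 :\ b) (c2 c),
      enlarges s c (c1 c) A1 & enlarges b (c1 c) (c2 c) (A1 :\ b)].
Proof.
case/and4P => V _ _ _; have [V1 E1] := removeP sA V.
by have [V2 E2] := removeP bA1 V1; split.
Qed.

(** The only common point of the two lines is [lo c s], which is strictly inside [b]. So no end of
    [b] was stopped by [s]. *)
Let removable_same c : removable_pair c -> c1 c b = c b.
Proof.
move=> R; have [V V1 V2 E1 E2] := removable_spec R.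
have /and4P[_ /insideP[ibp pl ph] _ _] := R.
have /validP[W _ _ _ _] := V.
have [is1 is2 is3] := W s sA; have [ib1 ib2 ib3] := W b bA.
rewrite [LHS]surjective_pairing [RHS]surjective_pairing; congr pair; apply: val_inj.
  apply/eqP/negPn/negP => /(enlarged_lo V1 V E1 bA1)/insideP[i _ _].
  by have := meet_uniq sb i ib1 is1 ibp; natlia.
apply/eqP/negPn/negP => /(enlarged_hi V1 V E1 bA1)/insideP[i _ _].
by have := meet_uniq sb i ib2 is1 ibp; natlia.
Qed.

(** An end that [b] stops only after the removal of [s] has been prolonged, hence was stopped by
    [s]: the loads of [s] and [b] add up. *)
Let removable_light c : removable_pair c -> #|blocked_set A1 (c1 c) b| <= D.*2.
Proof.
move=> R; have [V V1 V2 E1 E2] := removable_spec R.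
have eb := removable_same R; have /and4P[_ _ ds db] := R.
apply: (@leq_trans #|blocked_set A c b :|: blocked_set A c s|); last first.
  by apply: leq_trans (leq_card_setU _ _) _; rewrite -addnn leq_add.
apply: subset_leq_card; apply/subsetP => t; rewrite !inE => /andP[/andP[ts tA]].
have tA1 : t \in A1 by apply/setD1P.
rewrite tA /= /blocks_end ts => /andP[-> /=].
have [el|nl] := eqVneq (lo (c1 c) t) (lo c t); last first.
  by rewrite (enlarged_lo V1 V E1 tA1 nl) !orbT.
have [eh|nh] := eqVneq (hi (c1 c) t) (hi c t); last first.
  by rewrite (enlarged_hi V1 V E1 tA1 nh) !orbT.
by rewrite el eh /inside /lo /hi eb => ->.
Qed.

(** The segment of [b] needs a count on each side of the meeting point, and its load may have
    doubled; that of [s] starts at the meeting point, so one count is enough. *)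
Definition pair_code_type : finType :=
  (('I_(D.*2).+1 * 'I_(D.*2).+1 * {ffun 'I_(D.*2) -> 'I_3}) *
   ('I_D.+1 * {ffun 'I_D -> 'I_3}))%type.

(* The vertex [lo c s] is the meeting point of the two lines, and the segments to
   restore are located from it by the number of obstacles which they pass. *)
Definition pair_code c : config * pair_code_type :=
  (c2 c, ((inord (hit_count A1 b (c2 c) (lo (c1 c) b) (lo c s)),
           inord (hit_count A1 b (c2 c) (lo c s) (hi (c1 c) b)),
           cut_vector A1 b (c2 c) (D.*2) (c1 c)),
          (inord (hit_count A s (c1 c) (lo c s) (hi c s)),
           cut_vector A s (c1 c) D c))).

Lemma pair_code_inj : {in [set c | removable_pair c] &, injective pair_code}.
Proof.
move=> c d; rewrite !inE => Rc Rd.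
have [V V1 V2 E1 E2] := removable_spec Rc.
have [W W1 W2 F1 F2] := removable_spec Rd.
have /and4P[_ /insideP[cbp cpl cph] ds db] := Rc.
have /and4P[_ /insideP[dbp dpl dph] ds' db'] := Rd.
have /validP[X _ _ _ _] := V; have [csl csh cslh] := X s sA; have [cbl cbh cblh] := X b bA.
have /validP[Y _ _ _ _] := W; have [dsl dsh dslh] := Y s sA; have [dbl dbh dblh] := Y b bA.
have ep : lo c s = lo d s by apply: (meet_uniq sb).
have [clb chb] : lo (c1 c) b = lo c b /\ hi (c1 c) b = hi c b.
  by rewrite /lo /hi removable_same.
have [dlb dhb] : lo (c1 d) b = lo d b /\ hi (c1 d) b = hi d b.
  by rewrite /lo /hi removable_same.
rewrite /pair_code => -[] e2 ej1 ej2 ek1.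
have hcl := hits_lo bA1 V1 E2; have hdl := hits_lo bA1 W1 F2.
have hch := hits_hi bA1 V1 E2; have hdh := hits_hi bA1 W1 F2.
have bound c' x y : removable_pair c' -> lo (c1 c') b <= x -> y <= hi (c1 c') b ->
    hit_count A1 b (c2 c') x y < (D.*2).+1.
  move=> R lx yh; have [P P1 P2 Q1 Q2] := removable_spec R.
  by rewrite ltnS; apply: leq_trans (hit_count_bound bA1 P2 P1 Q2 lx yh) (removable_light R).
have elo : lo (c1 c) b = lo (c1 d) b.
  congr val; apply: (@hit_count_lo_inj A1 b (c2 c) _ _ (lo c s)) => //.
  - by rewrite -/(lo _ b) clb.
  - by rewrite -/(lo _ b) dlb.
  - by rewrite e2.
  - by rewrite -/(lo _ b) clb.
  - by rewrite -/(lo _ b) dlb ep.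
  - move/(congr1 val): ej1; rewrite /= !inordK; first by rewrite e2 ep.
      by apply: bound => //; rewrite dhb ltnW.
    by apply: bound => //; rewrite chb ltnW.
have ehi : hi (c1 c) b = hi (c1 d) b.
  congr val; apply: (@hit_count_hi_inj A1 b (c2 c) _ _ (lo c s)) => //.
  - by rewrite -/(hi _ b) chb.
  - by rewrite -/(hi _ b) dhb.
  - by rewrite e2.
  - by rewrite -/(hi _ b) chb.
  - by rewrite -/(hi _ b) dhb ep.
  - move/(congr1 val): ej2; rewrite /= !inordK; first by rewrite e2 ep.
      by apply: bound => //; rewrite dlb ltnW.
    by apply: bound => //; rewrite clb ltnW.
(* Decoding undoes the removals in reverse order: [b] is restored first, and the hit counts for [s]
   are then read in the common configuration [c1 c]. *)
have e1 : c1 c = c1 d.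
  apply: (@reinsert_inj A1 b (c2 c) bA1 V2 (D.*2)) => //; first by rewrite e2.
    exact: removable_light.
  by rewrite ek1 e2.
move=> ej3 ek2.
have hcs := hits_hi sA V E1; have hds := hits_hi sA W F1.
have ehs : hi c s = hi d s.
  congr val; apply: (@hit_count_hi_inj A s (c1 c) _ _ (lo c s)) => //.
  - by rewrite e1.
  - by rewrite -/(hi d s) ep.
  - move/(congr1 val): ej3; rewrite /= !inordK; first by rewrite e1 ep.
      rewrite ltnS; apply: (leq_trans _ ds'); apply: (hit_count_bound sA W1 W F1) => //; exact: leqnn.
    rewrite ltnS; apply: (leq_trans _ ds); apply: (hit_count_bound sA V1 V E1) => //; exact: leqnn.
apply: (@reinsert_inj A s (c1 c) sA V1 D) => //; first by rewrite e1.
by rewrite ek2 e1.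
Qed.

Lemma card_removable_pair : #|[set c | removable_pair c]| <=
  #|[set c | valid (A :\ s :\ b) c]| * ((D.*2).+1 ^ 2 * 3 ^ D.*2 * (D.+1 * 3 ^ D)).
Proof.
rewrite -(card_in_imset pair_code_inj).
apply: (@leq_trans #|setX [set c | valid (A1 :\ b) c] [set: pair_code_type]|).
  apply: subset_leq_card; apply/subsetP => _ /imsetP[c + ->]; rewrite !inE andbT.
  by move=> /removable_spec[].
by rewrite cardsX cardsT !card_prod !card_ffun !card_ord mulnn.
Qed.

End RemovePair.

(** * Counting the configurations *)

Definition blocker A c l := [pick m in A | (m != l) && inside c m (lo c l)].

Definition right_load A c s := #|[set t in A | (t != s) && inside c s (hi c t)]|.

(** The left end is the unique common point with the line of the blocker; the value [None] means the
    end of the chord. *)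
Lemma blocker_lo A c d l : l \in A -> valid A c -> valid A d ->
  blocker A c l = blocker A d l -> lo c l = lo d l.
Proof.
move=> lA Vc Vd; have /validP[C1 C2 _ _ _] := Vc; have /validP[D1 D2 _ _ _] := Vd.
have [c1 _ _] := C1 l lA; have [d1 _ _] := D1 l lA.
rewrite /blocker; case: pickP => [m /and3P[mA ml /insideP[i1 _ _]]|nc].
  case: pickP => // _ /[swap] -[<-] /and3P[_ _ /insideP[i2 _ _]].
  exact: (meet_uniq ml i1 c1 i2 d1).
case: pickP => // nd _; case: (C2 l lA) => [->|/blockedP[m [mA ml im]]]; last first.
  by have := nc m; rewrite mA ml im.
case: (D2 l lA) => [->//|/blockedP[m [mA ml im]]].
by have := nd m; rewrite mA ml im.
Qed.

(* Sweeping from left to right: when two segments meet, the one that stops is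
   the one that has already stopped all the segments it has to stop. *)
Lemma sweep_inj A c d : valid A c -> valid A d ->
  (forall l, l \in A -> lo c l = lo d l) ->
  (forall l, l \in A -> right_load A c l = right_load A d l) -> c = d.
Proof.
move=> Vc Vd elo ew.
have /validP[_ _ _ _ Cd] := Vc; have /validP[_ _ _ _ Dd] := Vd.
suff ehi l : l \in A -> hi c l = hi d l.
  apply/ffunP => l; have [lA|lA] := boolP (l \in A); last by rewrite Cd ?Dd.
  rewrite [LHS]surjective_pairing [RHS]surjective_pairing.
  by congr pair; apply: val_inj; [exact: elo|exact: ehi].
move=> lA; apply/eqP/negPn/negP => ne.
(* Among the segments whose right ends disagree, take one whose disagreement shows first. *)
pose P l := (l \in A) && (hi c l != hi d l).
have Pl : P l by rewrite /P lA.
case: (arg_minnP (fun l => minn (hi c l) (hi d l)) Pl) => m /andP[mA nem] min_m.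
have {}min_m t : t \in A -> minn (hi c t) (hi d t) < minn (hi c m) (hi d m) ->
    hi c t = hi d t.
  move=> tA lt; apply/eqP/negPn/negP => net; have := min_m t; rewrite /P tA net.
  by move=> /(_ isT); rewrite leqNgt lt.
move: nem min_m; clear l ne P Pl lA.
wlog lt : c d Vc Vd elo ew Cd Dd / hi c m < hi d m => [W nem min_m|_].
  case: (ltngtP (hi c m) (hi d m)) => lt.
  - exact: (W c d).
  - apply: (W d c) => //; last by move=> t tA lt'; rewrite min_m // minnC [X in _ < X]minnC.
    + by move=> t tA; rewrite elo.
    + by move=> t tA; rewrite ew.
    + by rewrite eq_sym.
  - by rewrite lt eqxx in nem.
have -> : minn (hi c m) (hi d m) = hi c m by rewrite /minn lt.
move=> early.
have /validP[C1 C2 C3 C4 _] := Vc; have /validP[D1 D2 D3 D4 _] := Vd.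
have [i1 i2 i3] := C1 m mA; have [j1 j2 j3] := D1 m mA.
have imd : inside d m (hi c m) by apply/insideP; split; rewrite -?elo.
case: (C3 m mA) => [e|/blockedP[b [bA bm /insideP[k1 k2 k3]]]].
  by have := inc_bounds j2; natlia.
(* In [d] the segment [m] runs on through this point. There [b] cannot pass, by noncrossing, nor can
   it have stopped before, since earlier right ends agree. *)
have hib : hi d b = hi c m.
  apply/eqP; rewrite eqn_leq; apply/andP; split.
    rewrite leqNgt; apply/negP => lt'; apply: (D4 m b (hi c m)) => //.
      by rewrite eq_sym.
    by apply/insideP; rewrite -elo.
  rewrite leqNgt; apply/negP => lt'.
  have : hi c b = hi d b by apply: early => //; rewrite gtn_min lt' orbT.
  by move=> e; rewrite e in k3; natlia.
(* All right ends that [m] stops in [c] come earlier and are stopped in [d] too, where [m] also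
   stops [b]. *)
suff : right_load A c m < right_load A d m by rewrite ew // ltnn.
apply: proper_card; apply/properP; split.
  apply/subsetP => t; rewrite !inE => /and3P[tA tm /insideP[r1 r2 r3]].
  have e : hi c t = hi d t by apply: early; rewrite // gtn_min r3.
  by rewrite tA tm; apply/insideP; rewrite -e -elo //; split=> //; natlia.
exists b; first by rewrite !inE bA bm hib.
rewrite !inE bA bm /=; apply/insideP => -[_ _ h]; natlia.
Qed.

Lemma inside_count A c z t : valid A c -> #|[set s in A | (t != s) && inside c s z]| <= 1.
Proof.
case/validP => _ _ _ X _; apply/card_le1_eqP => s s'; rewrite !inE.
move=> /and3P[sA ts is1] /and3P[sA' ts' is2].
by apply/eqP/negPn/negP => ne; apply: (X s s' z) => //; rewrite eq_sym.
Qed.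

Lemma card_sum A (P : pred I) : #|[set t in A | P t]| = \sum_(t in A) P t.
Proof.
by rewrite -sum1dep_card big_mkcondr; apply: eq_bigr => t _; case: (P t).
Qed.

Lemma sum_right_load A c : valid A c -> \sum_(s in A) right_load A c s <= #|A|.
Proof.
move=> V; rewrite (eq_bigr _ (fun s _ => card_sum A _)) exchange_big /=.
rewrite -sum1_card leq_sum // => t tA; rewrite -card_sum; exact: inside_count.
Qed.

Lemma sum_blocked_set A c : valid A c -> \sum_(s in A) #|blocked_set A c s| <= #|A|.*2.
Proof.
move=> V; rewrite (eq_bigr _ (fun s _ => card_sum A _)) exchange_big /=.
rewrite -muln2 -sum_nat_const leq_sum // => t tA; rewrite -card_sum.
apply: leq_trans (leq_add (inside_count (lo c t) t V) (inside_count (hi c t) t V)).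
apply: leq_trans (leq_card_setU _ _); apply: subset_leq_card; apply/subsetP => s.
by rewrite !inE /blocks_end => /and3P[-> -> /orP[]->]; rewrite ?orbT.
Qed.

(** * Configurations with few light pairs, and with many *)

Section FewLight.

Variables (A : {set I}) (D n0 : nat).

Definition light c s := #|blocked_set A c s| <= D.

Definition light_pairs c := [set s in A | light c s &&
  (if blocker A c s is Some b then light c b else false)].

Definition heavy c := [set s in A | ~~ light c s].

Lemma card_heavy c : valid A c -> #|heavy c| * D.+1 <= #|A|.*2.
Proof.
move=> V; apply: leq_trans (sum_blocked_set V); rewrite -sum_nat_const.
rewrite [leqRHS](bigID (mem (heavy c))) /= -[leqLHS]addn0 leq_add //.
rewrite [leqRHS](eq_bigl (mem (heavy c))); last first.
  by move=> s; rewrite !inE andbA andbb.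
by apply: leq_sum => s; rewrite inE /light -ltnNge => /andP[].
Qed.

Definition excess c := heavy c :|: light_pairs c.

Definition few c := valid A c && (#|light_pairs c| < n0).

Lemma blocker_heavy c l m : l \in A -> l \notin excess c ->
  blocker A c l = Some m -> m \in heavy c.
Proof.
move=> lA; rewrite !inE lA /= negb_or negbK => /andP[ll]; rewrite ll => nm.
rewrite /blocker in nm *; case: pickP nm => // x /andP[xA _] nl [<-].
by rewrite xA nl.
Qed.

(* Outside the excess set, the left blocker of a segment is heavy. *)
Definition blocker_choices (HE : {set I} * {set I}) l : pred (option I) :=
  if l \in HE.2 then predT else if l \notin A then pred1 None else
  [pred o | if o is Some m then m \in HE.1 else true].

Let K := #|I|.

Definition blocker_fun c : {ffun I -> option I} :=
  [ffun l => if l \in A then blocker A c l else None].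

Definition load_fun c : {ffun I -> 'I_K.+1} :=
  [ffun l => if l \in A then inord (right_load A c l) else ord0].

(** Blockers and loads determine [c]; the two sets are recorded to restrict the range of the
    blockers. *)
Definition few_code c := ((heavy c, excess c), (blocker_fun c, load_fun c)).

Lemma right_load_ord c l : right_load A c l < K.+1.
Proof. by rewrite ltnS max_card. Qed.

Lemma few_code_inj : {in [set c | few c] &, injective few_code}.
Proof.
move=> c d; rewrite !inE => /andP[Vc _] /andP[Vd _] [_ _ /ffunP eb /ffunP el].
apply: (sweep_inj Vc Vd) => l lA.
  by apply: (blocker_lo lA Vc Vd); have := eb l; rewrite !ffunE lA.
have := congr1 val (el l); rewrite !ffunE lA /= !inordK //; exact: right_load_ord.
Qed.

Lemma card_blocker_choices HE :
  #|family (blocker_choices HE)| <= K.+1 ^ #|HE.2| * #|HE.1|.+1 ^ #|A|.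
Proof.
rewrite card_family foldrE big_image /=.
apply: (@leq_trans (\prod_l ((if l \in HE.2 then K.+1 else 1) *
                             (if l \in A then #|HE.1|.+1 else 1)))).
  apply: leq_prod => l _; rewrite /blocker_choices.
  case: (boolP (l \in HE.2)) => lE.
    by rewrite -[leqLHS]muln1 leq_mul ?card_option -?card_option ?max_card //; case: ifP.
  case: (boolP (l \in A)) => lA /=; last by rewrite card1.
  rewrite mul1n; apply: (@leq_trans #|None |: [set Some m | m in HE.1]|).
    apply: subset_leq_card; apply/subsetP => -[m|]; rewrite !inE // => mH.
    by apply: imset_f.
  by rewrite cardsU1 -[leqRHS]add1n leq_add ?leq_imset_card ?leq_b1.
rewrite big_split /= -!big_mkcond /= !prod_nat_const //.
Qed.

(** Stars and bars: the count is ['C(K + n, K)], one term of the expansion of (1 + 1)^(K + n). The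
    bound on the total load makes the loads cost only C^K. *)
Lemma card_loads (n : nat) : #|[set f : {ffun I -> 'I_n.+1} | \sum_l f l <= n]| <= 2 ^ (K + n).
Proof.
apply: (@leq_trans 'C(K + n, K)); last first.
  have lt : K < (K + n).+1 by rewrite ltnS leq_addr.
  rewrite -[2]/(1 + 1) expnDn (bigD1 (Ordinal lt)) //= !exp1n !muln1; exact: leq_addr.
rewrite -card_partial_ord_partitions -(card_in_imset (f := @fgraph _ _)); last first.
  by move=> f g _ _ e; rewrite -(fgraphK f) e fgraphK.
apply: subset_leq_card; apply/subsetP => _ /imsetP[f + ->]; rewrite !inE.
by rewrite -codom_ffun big_image.
Qed.

(** Half of the exponent [4 * K] pays for the two sets [heavy c] and [excess c], the other half for
    the loads. *)
Lemma card_few h : (forall c, valid A c -> #|heavy c| <= h) ->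
  #|[set c | few c]| <= 2 ^ (4 * K) * (K.+1 ^ (h + n0) * h.+1 ^ #|A|).
Proof.
move=> Hh.
pose P (HE : {set I} * {set I}) := (#|HE.1| <= h) && (#|HE.2| <= h + n0).
pose Q HE := setX [set f in family (blocker_choices HE)]
                  [set f : {ffun I -> 'I_K.+1} | \sum_l f l <= K].
rewrite -(card_in_imset few_code_inj).
apply: (@leq_trans #|[set p | P p.1 && (p.2 \in Q p.1)]|).
  apply: subset_leq_card; apply/subsetP => _ /imsetP[c + ->].
  rewrite inE => /andP[V lt]; rewrite inE in_setX /P /= Hh // 2!inE; apply/and3P; split.
  - by apply: leq_trans (leq_card_setU _ _) _; rewrite leq_add ?Hh 1?ltnW.
  - apply/familyP => l; rewrite /blocker_choices ffunE /=.
    case: (boolP (l \in A)) => lA; case: (boolP (l \in excess c)) => lE //.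
    case e: (blocker A c l) => [m|] //; rewrite unfold_in.
    exact: blocker_heavy e.
    rewrite inE; apply: leq_trans (max_card (mem A)).
    apply: leq_trans (sum_right_load V); rewrite [leqRHS]big_mkcond /=.
    apply: leq_sum => l _; rewrite ffunE; case: ifP => //= _.
    by rewrite inordK // right_load_ord.
rewrite -sum1_card (eq_bigl (fun p => P p.1 && (p.2 \in Q p.1))); last by move=> p; rewrite inE.
rewrite -(pair_big_dep P (fun HE => mem (Q HE)) (fun _ _ => 1)) /=.
apply: (@leq_trans (\sum_(HE | P HE) 2 ^ K.*2 * (K.+1 ^ (h + n0) * h.+1 ^ #|A|))).
  apply: leq_sum => HE /andP[H1 H2]; rewrite sum1_card cardsX mulnC leq_mul //.
    by rewrite -addnn card_loads.
  rewrite cardsE; apply: leq_trans (card_blocker_choices HE) _.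
  by rewrite leq_mul ?leq_pexp2l //; case: #|A| => // a; rewrite leq_exp2r.
rewrite sum_nat_const mulnA leq_mul2r; apply/orP; right.
apply: (@leq_trans (2 ^ K.*2 * 2 ^ K.*2)); last by rewrite -expnD leq_exp2l //; lia.
rewrite leq_mul2r; apply/orP; right; apply: leq_trans (max_card _) _.
by rewrite card_prod -cardsT -powersetT card_powerset cardsT -expnD addnn.
Qed.

Definition many c := valid A c && (n0 <= #|light_pairs c|).

(** The cardinality of [pair_code_type D]. *)
Definition reinsertions := (D.*2).+1 ^ 2 * 3 ^ D.*2 * (D.+1 * 3 ^ D).

(** Double counting: each [s] in [light_pairs c] gives, with its left blocker, a pair that is
    removable from [c]. *)
Lemma card_many : n0 * #|[set c | many c]| <=
  \sum_(s in A) \sum_(b in A :\ s) #|[set c | valid (A :\ s :\ b) c]| * reinsertions.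
Proof.
rewrite mulnC -sum_nat_const.
apply: (@leq_trans (\sum_(c in [set c | many c])
    \sum_(s in A) \sum_(b in A :\ s) removable_pair A s b D c)).
  apply: leq_sum => c; rewrite inE => /andP[V /leq_trans]; apply.
  rewrite /light_pairs card_sum; apply: leq_sum => s sA /=; case ls: (light c s) => //=.
  rewrite /blocker; case: pickP => // b /and3P[bA bs ib]; case lb: (light c b) => //.
  have bA' : b \in A :\ s by apply/setD1P.
  by rewrite (bigD1 b bA') /= /removable_pair V ib -/(light c s) ls -/(light c b) lb.
rewrite exchange_big /=; apply: leq_sum => s sA; rewrite exchange_big /=.
apply: leq_sum => b /setD1P[bs bA].
apply: leq_trans (card_removable_pair D sA bA _); last by rewrite eq_sym.
rewrite -sum1dep_card big_mkcond [leqRHS]big_mkcond /=; apply: leq_sum => c _.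
by case: ifP => // _; case: (removable_pair _ _ _ _ _).
Qed.

End FewLight.

(** * The recursion on the set of lines *)

Section Recursion.

Variables (lam D n0 G Y : nat).
Hypothesis n0_gt0 : 0 < n0.
Hypothesis few_bound : forall A,
  #|[set c | few A D n0 c]| * lam ^ #|A| <= G * Y ^ #|A|.
Hypothesis many_bound : #|I| ^ 2 * reinsertions D * lam ^ 2 <= n0 * Y ^ 2.

(** Read as a bound (#A + 1) G (Y / lam)^#A without division. By [many_bound] the removal of two
    lines costs at most (Y / lam)^2, so the configurations with many light pairs inherit the bound
    for #A - 2; those with few add one more summand G, whence the factor #A + 1. *)
Lemma card_valid_rec A : #|[set c | valid A c]| * lam ^ #|A| <= #|A|.+1 * G * Y ^ #|A|.
Proof.
have [n] := ubnP #|A|; elim: n A => // n IHn A An.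
have split_valid : #|[set c | valid A c]| <=
    #|[set c | few A D n0 c]| + #|[set c | many A D n0 c]|.
  apply: leq_trans (leq_card_setU _ _); apply: subset_leq_card; apply/subsetP => c.
  by rewrite !inE /few /many => ->; rewrite /= ltnNge orNb.
apply: leq_trans (leq_mul split_valid (leqnn _)) _.
rewrite mulnDl -addn1 mulnDl mulnDl mul1n addnC leq_add //.
(* With fewer than two lines there is no pair to remove, so no configuration satisfies [many]. *)
have := card_many A D n0; have [a2|a2] := ltnP 1 #|A|; last first.
  rewrite [leqRHS]big1 => [|s sA].
    by rewrite leqn0 muln_eq0 eqn0Ngt n0_gt0 /= => /eqP ->.
  rewrite big_pred0 // => b; have := cardsD1 s A; rewrite sA => e.
  have : #|A :\ s| == 0 by rewrite eqn_leq; apply/andP; split=> //; lia.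
  by rewrite cards_eq0 => /eqP ->; rewrite inE.
move=> H; rewrite -(leq_pmul2l n0_gt0) mulnA.
apply: leq_trans (leq_mul H (leqnn _)) _; rewrite big_distrl /=.
have eA : #|A| = (#|A| - 2) + 2 by lia.
apply: (@leq_trans (\sum_(s in A) \sum_(b in A :\ s)
    (reinsertions D * lam ^ 2 * (#|A| * G * Y ^ (#|A| - 2))))).
  apply: leq_sum => s sA; rewrite big_distrl /=; apply: leq_sum => b bA.
  have := cardsD1 s A; have := cardsD1 b (A :\ s); rewrite sA bA => e1 e2.
  have e3 : #|A :\ s :\ b| = #|A| - 2 by lia.
  have := IHn (A :\ s :\ b); rewrite e3 => IH; have {IH}/IH IH : #|A| - 2 < n by lia.
  rewrite {1}eA expnD -mulnA [X in _ <= X]mulnAC.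
  rewrite [leqLHS](_ : _ = (#|[set c | valid (A :\ s :\ b) c]| * lam ^ (#|A| - 2)) *
    (reinsertions D * lam ^ 2)); last by ring.
  rewrite mulnC [leqRHS](_ : _ = (reinsertions D * lam ^ 2) * (#|A| * G * Y ^ (#|A| - 2))); last by ring.
  rewrite leq_mul2l; apply/orP; right; apply: leq_trans IH _.
  by rewrite -!mulnA leq_mul //; lia.
apply: (@leq_trans (\sum_(s in A) \sum_(b in A)
    (reinsertions D * lam ^ 2 * (#|A| * G * Y ^ (#|A| - 2))))).
  apply: leq_sum => s sA; rewrite [leqRHS](big_setD1 s sA) /=; exact: leq_addl.
rewrite !sum_nat_const mulnA.
have cA : #|A| * #|A| <= #|I| ^ 2 by rewrite -mulnn leq_mul ?max_card.
apply: leq_trans (leq_mul cA (leqnn _)) _.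
rewrite mulnA [X in X * _ <= _]mulnA.
apply: leq_trans (leq_mul many_bound (leqnn _)) _.
rewrite [X in _ <= _ * (_ * Y ^ X)]eA expnD.
by rewrite leq_eqVlt; apply/orP; left; apply/eqP; ring.
Qed.

End Recursion.

(** * Choice of the parameters *)

Lemma linear_le_exp2 n : n.+1 <= 2 ^ n.
Proof. exact: ltn_expl. Qed.

Lemma square_le_exp2 n : n ^ 2 <= 64 * 2 ^ (n %/ 4).
Proof.
have main q : q.+1 ^ 2 <= 4 * 2 ^ q.
  elim: q => // -[|[|q]] // IH; rewrite expnS mulnCA.
  apply: leq_trans (leq_mul (leqnn 2) IH); rewrite -!mulnn; nia.
apply: (@leq_trans ((4 * (n %/ 4).+1) ^ 2)); first by rewrite leq_exp2r //; lia.
by rewrite expnMn -[64]/(16 * 4) -mulnA leq_mul2l main.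
Qed.

Lemma reinsertions_le D : reinsertions D <= 2 ^ (11 * D).
Proof.
have p3 n : 3 ^ n <= 2 ^ n.*2 by rewrite -muln2 mulnC expnM; case: n => // n; rewrite leq_exp2r.
have e : 11 * D = ((D.*2) * 2 + D.*2.*2) + (D + D.*2) by lia.
rewrite /reinsertions e !expnD !leq_mul ?p3 ?linear_le_exp2 //.
by rewrite expnM leq_exp2r // linear_le_exp2.
Qed.

Theorem card_valid : 1 < #|I| ->
  #|[set c | valid [set: I] c]| * trunc_log 2 #|I| ^ #|I| <= 2 ^ (273 * #|I|) * #|I| ^ #|I|.
Proof.
set K := #|I| => K1; set lam := trunc_log 2 K.
have /andP[Klo Khi] := trunc_log_bounds (isT : 1 < 2) (ltnW K1 : 0 < K).
rewrite -/lam in Klo Khi.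
have lam_gt0 : 0 < lam by rewrite lt0n; apply: contraTneq Khi => ->; rewrite -leqNgt.
(* About the square root of K, [n0] is small enough for K^n0 to be absorbed in C^K, yet it pays for
   the reinsertions, at most 2^(11 D), and for lam^2, at most 64 * 2^(lam / 4): indeed 11 / 64 + 1 /
   4 < 1 / 2. *)
pose D := lam %/ 64; pose n0 := 2 ^ (lam %/ 2).
have D64 : lam <= 64 * D.+1 by rewrite /D; lia.
have n0_gt0 : 0 < n0 by rewrite expn_gt0.
pose h := K.*2 %/ D.+1.
have lamh : lam * h <= 128 * K.
  apply: leq_trans (leq_mul D64 (leqnn h)) _; rewrite -mulnA.
  apply: (@leq_trans (64 * K.*2)); last by lia.
  by rewrite leq_mul2l /= mulnC leq_divM.
have lamK : lam < K by apply: leq_trans Klo; exact: linear_le_exp2.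
have heavy_le A c : valid A c -> #|heavy A D c| <= h.
  move=> V; rewrite leq_divRL //; apply: leq_trans (card_heavy D V) _.
  by rewrite leq_double max_card.
have lam_n0 : lam.+1 * n0 <= 2 * K.
  apply: leq_trans (leq_mul (leqnn 2) Klo).
  have e : 2 ^ lam = 2 ^ (lam - lam %/ 2) * n0 by rewrite -expnD; congr (2 ^ _); lia.
  rewrite e mulnA leq_mul2r; apply/orP; right.
  by have := linear_le_exp2 (lam - lam %/ 2); lia.
(* The 129 comes from [lam * h.+1 <= 128 * K + K], and 264 = 4 + 260, where [260 * K] bounds
   [lam.+1 * (h + n0)]. *)
have few_le A : #|[set c | few A D n0 c]| * lam ^ #|A| <= 2 ^ (264 * K) * (129 * K) ^ #|A|.
  apply: leq_trans (leq_mul (card_few n0 (heavy_le A)) (leqnn _)) _.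
  rewrite -/K -mulnA -mulnA -expnMn.
  have e : 264 * K = 4 * K + 260 * K by lia.
  rewrite e (expnD 2 (4 * K)) -mulnA leq_mul2l; apply/orP; right; apply: leq_mul.
    apply: (@leq_trans (2 ^ (lam.+1 * (h + n0)))).
      by rewrite expnM; case: (h + n0) => // n; rewrite leq_exp2r.
    rewrite leq_exp2l // mulnDr; nia.
  case: #|A| => // a; rewrite leq_exp2r // mulSn mulnC; lia.
have many_le : #|I| ^ 2 * reinsertions D * lam ^ 2 <= n0 * (129 * K) ^ 2.
  rewrite -/K expnMn -mulnA [leqLHS]mulnC mulnA leq_mul2r; apply/orP; right.
  apply: leq_trans (leq_mul (reinsertions_le D) (square_le_exp2 lam)) _.
  rewrite mulnCA -expnD [leqRHS]mulnC; apply: leq_mul => //.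
  by rewrite leq_exp2l // /D; lia.
have := card_valid_rec n0_gt0 few_le many_le [set: I]; rewrite cardsT -/K => H.
apply: leq_trans H _; rewrite expnMn.
(* The three factors absorb K + 1, the constant [G], and 129^K with 129 <= 2^8. *)
have -> : 2 ^ (273 * K) = 2 ^ K * 2 ^ (264 * K) * 2 ^ (8 * K).
  by rewrite -!expnD; congr (2 ^ _); lia.
rewrite -[leqRHS]mulnA !leq_mul ?linear_le_exp2 // expnM.
by rewrite leq_exp2r // ltnW.
Qed.

End Arrangement.

Require Import Defs.
From mathcomp Require Import all_classical all_reals all_analysis.
Import Order.TTheory GRing.Theory Num.Theory numFieldNormedType.Exports.

Local Open Scope classical_set_scope.
Local Open Scope ring_scope.

(** * Plane geometry *)

Section Plane.

Variable R : realType.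
Local Notation V := 'rV[R]_2.
Implicit Types (a b p u v w x y z : V) (A B : set V).

Definition px (z : V) : R := z ord0 ord0.
Definition py (z : V) : R := z ord0 ord_max.

Lemma pxD a b : px (a + b) = px a + px b. Proof. by rewrite /px mxE. Qed.
Lemma pyD a b : py (a + b) = py a + py b. Proof. by rewrite /py mxE. Qed.
Lemma pxN a : px (- a) = - px a. Proof. by rewrite /px mxE. Qed.
Lemma pyN a : py (- a) = - py a. Proof. by rewrite /py mxE. Qed.
Lemma pxZ (t : R) a : px (t *: a) = t * px a. Proof. by rewrite /px mxE. Qed.
Lemma pyZ (t : R) a : py (t *: a) = t * py a. Proof. by rewrite /py mxE. Qed.
Lemma px0 : px 0 = 0. Proof. by rewrite /px mxE. Qed.
Lemma py0 : py 0 = 0. Proof. by rewrite /py mxE. Qed.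
Definition coordE := (pxD, pyD, pxN, pyN, pxZ, pyZ, px0, py0).

Lemma plane_ext a b : px a = px b -> py a = py b -> a = b.
Proof.
move=> ex ey; apply/rowP => -[[|[|//]] i]; first by rewrite (_ : Ordinal i = ord0) //; exact: val_inj.
by rewrite (_ : Ordinal i = ord_max) //; exact: val_inj.
Qed.

Definition cross (u v : V) : R := px u * py v - py u * px v.

Lemma nbhs_affine_gt0 (al be ga : R) z : 0 < al * px z + be * py z + ga ->
  nbhs z [set y | 0 < al * px y + be * py y + ga].
Proof.
move=> H; have cx : continuous px by exact: coord_continuous.
have cy : continuous py by exact: coord_continuous.
have cf : continuous (fun y => al * px y + be * py y + ga).
  move=> y; apply: (@cvgD _ _ _ (nbhs y)); last exact: cvg_cst.
  by apply: (@cvgD _ _ _ (nbhs y)); apply: cvgMl_tmp; [exact: cx|exact: cy].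
by have /cvgr_gt := cf z; apply.
Qed.

Lemma nbhs_cross_gt0 (c : R) u a z : 0 < c + cross u (z - a) ->
  nbhs z [set y | 0 < c + cross u (y - a)].
Proof.
have e y : c + cross u (y - a) = - py u * px y + px u * py y +
    (c + py u * px a - px u * py a) by rewrite /cross !coordE; ring.
by rewrite e => /nbhs_affine_gt0; apply: filterS => y /=; rewrite e.
Qed.

Lemma nbhs_dir z v A : nbhs z A ->
  exists2 d : R, 0 < d & forall t, `|t| < d -> A (z + t *: v).
Proof.
move=> nA; have : (fun t : R => z + t *: v) @ (0 : R) --> z + (0 : R) *: v.
  by apply: cvgD; [exact: cvg_cst|apply: cvgZr_tmp; exact: cvg_id].
rewrite scale0r addr0 => /(_ A nA) /nbhs_ballP[d /= d0 H].
exists d => // t td; apply: H; rewrite /ball /= sub0r normrN; exact: td.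
Qed.

Lemma convexP A a b (t : R) : convex_set A -> A a -> A b -> 0 <= t <= 1 ->
  A ((1 - t) *: a + t *: b).
Proof.
move=> cA Aa Ab /andP[t0 t1].
have [->|tn0] := eqVneq t 0; first by rewrite subr0 scale1r scale0r addr0.
have [->|tn1] := eqVneq t 1; first by rewrite subrr scale1r scale0r add0r.
have s0 : 0 <= 1 - t by rewrite subr_ge0.
have s1 : 1 - t <= 1 by rewrite gerBl.
have := cA a b (Itv01 s0 s1); rewrite !inE => /(_ Aa Ab); rewrite /conv /=.
by rewrite /unstable.onem opprB addrCA subrr addr0.
Qed.

(** The homothety with centre [b] and ratio [1 - t] carries a ball about [a] in [A] to a ball in
    [A]. *)
Lemma interior_convex A a b (t : R) : convex_set A -> A° a -> A b -> 0 <= t < 1 ->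
  A° ((1 - t) *: a + t *: b).
Proof.
move=> cA /nbhs_ballP[r /= r0 H] Ab /andP[t0 t1].
have s0 : 0 < 1 - t by rewrite subr_gt0.
apply/nbhs_ballP; exists ((1 - t) * r) => /=; first by rewrite mulr_gt0.
move=> y; rewrite -ball_normE /ball_ /= => yr.
pose w : V := (1 - t)^-1 *: (y - t *: b).
have -> : y = (1 - t) *: w + t *: b.
  by rewrite /w scalerA divff ?gt_eqF // scale1r subrK.
apply: convexP => //; last by rewrite t0 ltW.
apply: H; rewrite -ball_normE /ball_ /=.
have -> : a - w = (1 - t)^-1 *: ((1 - t) *: a + t *: b - y).
  by apply: plane_ext; rewrite /w !coordE; field; rewrite gt_eqF.
by rewrite normrZ gtr0_norm ?invr_gt0 // mulrC ltr_pdivrMr // mulrC.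
Qed.

Lemma interior_dense A O y : convex_set A -> A° !=set0 -> A y -> nbhs y O ->
  exists2 z, A° z & O z.
Proof.
move=> cA [x Ax] Ay /(nbhs_dir (x - y))[d d0 H].
pose t := Num.min (d / 2) 1.
have t0 : 0 < t by rewrite lt_min ltr01 andbT divr_gt0.
have t1 : t <= 1 by rewrite ge_min lexx orbT.
have td : t < d by rewrite gt_min ltr_pdivrMr // ltr_pMr // ltr1n.
exists (y + t *: (x - y)); last by apply: H; rewrite gtr0_norm.
have -> : y + t *: (x - y) = (1 - (1 - t)) *: x + (1 - t) *: y.
  by apply: plane_ext; rewrite !coordE; ring.
by apply: interior_convex => //; rewrite subr_ge0 t1 ltrBlDr ltrDl.
Qed.

Lemma convex_triangle A a b w (s t : R) : convex_set A -> A a -> A b -> A w ->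
  0 < s -> 0 <= t -> s + t < 1 -> A (a + s *: (b - a) + t *: (w - a)).
Proof.
move=> cA Aa Ab Aw s0 t0 st.
have t1 : 0 < 1 - t by lra.
have -> : a + s *: (b - a) + t *: (w - a) =
    (1 - t) *: ((1 - s / (1 - t)) *: a + (s / (1 - t)) *: b) + t *: w.
  by apply: plane_ext; rewrite !coordE; field; rewrite gt_eqF.
apply: convexP => //; last by lra.
apply: convexP => //; apply/andP; split; first by rewrite divr_ge0 // ltW.
by rewrite ler_pdivrMr //; lra.
Qed.

(* Near an inner point of the side [a, b] of the triangle [a, b, w], the points
   on the same side of [a, b] as [w] are in the triangle. *)
Lemma near_triangle A a b w (t : R) : convex_set A -> A a -> A b -> A w ->
  cross (b - a) (w - a) != 0 -> 0 < t < 1 ->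
  nbhs (a + t *: (b - a))
    [set y | 0 <= cross (b - a) (w - a) * cross (b - a) (y - a) -> A y].
Proof.
move=> cA Aa Ab Aw; set u := b - a; set k := cross u (w - a) => k0 /andP[t0 t1].
(* By Cramer's rule, [s y] and [r y] are the coordinates of [y] in the frame [u], [w - a] at [a]. *)
pose s y := cross (- k^-1 *: (w - a)) (y - a).
pose r y := cross (k^-1 *: u) (y - a).
have decomp y : y = a + s y *: u + r y *: (w - a).
  by apply: plane_ext; rewrite /s /r /cross !coordE; move: k0;
    rewrite /k /u /cross !coordE => k0; field.
have st : s (a + t *: u) = t.
  by rewrite /s /cross !coordE; move: k0; rewrite /k /u /cross !coordE => k0; field.
have rt : r (a + t *: u) = 0 by rewrite /r /cross !coordE; ring.
have H1 : nbhs (a + t *: u) [set y | 0 < 0 + s y].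
  by apply: nbhs_cross_gt0; rewrite -/(s _) st add0r.
have H2 : nbhs (a + t *: u) [set y | 0 < 1 + cross (k^-1 *: (w - a) - k^-1 *: u) (y - a)].
  apply: nbhs_cross_gt0; rewrite [X in 0 < X](_ : _ = 1 - s (a + t *: u) - r (a + t *: u)).
    by rewrite st rt; lra.
  by rewrite /s /r /cross !coordE; ring.
have k2 : 0 < k ^+ 2 by rewrite exprn_even_gt0.
apply: filterS2 H1 H2 => y /=; rewrite -/u -/k => s0 sr kr.
rewrite (decomp y); apply: convex_triangle => //; first by rewrite add0r in s0.
  rewrite /r (_ : cross _ _ = (k * cross u (y - a)) / k ^+ 2).
    by rewrite divr_ge0 // ltW.
  by rewrite /cross !coordE; field.
move: sr; rewrite [X in 0 < X](_ : _ = 1 - s y - r y); first by lra.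
by rewrite /s /r /cross !coordE; ring.
Qed.

Lemma near_side A a b w (t : R) : convex_set A -> A a -> A b -> A w ->
  cross (b - a) (w - a) != 0 -> 0 < t < 1 ->
  nbhs (a + t *: (b - a))
    [set y | 0 < cross (b - a) (w - a) * cross (b - a) (y - a) -> A° y].
Proof.
move=> cA Aa Ab Aw k0 t01; have := nbhs_interior (near_triangle cA Aa Ab Aw k0 t01).
apply: filterS => y /= Sy ky; set k := cross (b - a) (w - a) in Sy ky *.
have e z : k * cross (b - a) (z - a) = 0 + cross (k *: (b - a)) (z - a).
  by rewrite /cross !coordE; ring.
rewrite e in ky; have := nbhs_cross_gt0 ky; apply: filterS2 Sy => z /= Sz kz.
by apply: Sz; rewrite e ltW.
Qed.

Definition perp u : V := \row_j (if j == ord0 then - py u else px u).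

Lemma pxperp u : px (perp u) = - py u. Proof. by rewrite /px mxE. Qed.
Lemma pyperp u : py (perp u) = px u. Proof. by rewrite {1}/py mxE. Qed.

Lemma norm2_gt0 u : u != 0 -> 0 < px u ^+ 2 + py u ^+ 2.
Proof.
move=> u0; rewrite lt_neqAle addr_ge0 ?sqr_ge0 // andbT eq_sym paddr_eq0 ?sqr_ge0 //.
rewrite !sqrf_eq0; apply: contra u0 => /andP[/eqP ex /eqP ey].
by apply/eqP/plane_ext; rewrite ?px0 ?py0.
Qed.

Lemma off_line A a u : A° !=set0 -> u != 0 -> exists2 w, A w & cross u (w - a) != 0.
Proof.
move=> [x Ax] u0; have [e|ne] := eqVneq (cross u (x - a)) 0; last first.
  by exists x => //; exact: interior_subset.
have [d d0 H] := nbhs_dir (perp u) Ax.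
exists (x + (d / 2) *: perp u).
  by apply: H; rewrite gtr0_norm ?divr_gt0 // ltr_pdivrMr // ltr_pMr // ltr1n.
have -> : cross u (x + (d / 2) *: perp u - a) =
    cross u (x - a) + d / 2 * (px u ^+ 2 + py u ^+ 2).
  by rewrite /cross !coordE pxperp pyperp; ring.
by rewrite e add0r mulf_neq0 ?gt_eqF ?norm2_gt0 // divr_gt0.
Qed.

Lemma line_segmentP a b y : line_segment a b y <->
  exists2 t : R, 0 <= t <= 1 & y = a + t *: (b - a).
Proof.
rewrite /line_segment /=; split=> -[t]; rewrite /= ?in_itv /= => t01.
  by move=> <-; exists t => //; apply: plane_ext; rewrite !coordE; ring.
move=> ->; exists t; first by rewrite in_itv.
by apply: plane_ext; rewrite !coordE; ring.
Qed.

Lemma segment_param_inj a b (q r : R) : a != b ->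
  a + q *: (b - a) = a + r *: (b - a) -> q = r.
Proof.
move=> ab /addrI/eqP; rewrite -subr_eq0 -scalerBl scaler_eq0 !subr_eq0.
by rewrite [b == a]eq_sym (negbTE ab) orbF => /eqP.
Qed.

Lemma line_segment_sym a b : line_segment a b = line_segment b a.
Proof.
have H x y z : line_segment x y z -> line_segment y x z.
  move=> /line_segmentP[t /andP[t0 t1] ->]; apply/line_segmentP; exists (1 - t).
    by apply/andP; split; lra.
  by apply: plane_ext; rewrite !coordE; ring.
by apply/seteqP; split => z; exact: H.
Qed.

Lemma line_segment_l a b : line_segment a b a.
Proof. by apply/line_segmentP; exists 0; rewrite ?lexx ?ler01 // scale0r addr0. Qed.

Lemma line_segment_r a b : line_segment a b b.
Proof. by rewrite line_segment_sym; exact: line_segment_l. Qed.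

Lemma line_segment_sub A a b : convex_set A -> A a -> A b -> line_segment a b `<=` A.
Proof.
move=> cA Aa Ab y /line_segmentP[t t01 ->].
have -> : a + t *: (b - a) = (1 - t) *: a + t *: b.
  by apply: plane_ext; rewrite !coordE; ring.
exact: convexP.
Qed.

Lemma line_segment_between a b x y : line_segment a b x -> line_segment a b y ->
  line_segment x y `<=` line_segment a b.
Proof.
move=> /line_segmentP[r /andP[r0 r1] ->] /line_segmentP[s /andP[s0 s1] ->] z.
move=> /line_segmentP[t /andP[t0 t1] ->]; apply/line_segmentP.
exists (r + t * (s - r)); last by apply: plane_ext; rewrite !coordE; ring.
by apply/andP; split; nra.
Qed.

Lemma convex_line_segment a b : convex_set (line_segment a b).
Proof.
apply/convex_setW => x y; rewrite !inE => sx sy k _ _.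
apply/mem_set/(line_segment_between sy sx)/line_segmentP; exists k%:num.
  by apply/andP; split.
by apply: plane_ext; rewrite /conv /= /unstable.onem !coordE; ring.
Qed.

Lemma line_segment_image a b :
  line_segment a b = [set a + t *: (b - a) | t in `[0, 1]%classic].
Proof.
apply/seteqP; split=> y; first by move=> /line_segmentP[t t01 ->]; exists t; rewrite //= in_itv.
by move=> [t /=]; rewrite in_itv /= => t01 <-; apply/line_segmentP; exists t.
Qed.

Lemma continuous_line p u : continuous (fun t : R => p + t *: u).
Proof. by move=> t; apply: cvgD; [exact: cvg_cst|apply: cvgZr_tmp; exact: cvg_id]. Qed.

Lemma line_segment_connected a b : connected (line_segment a b).
Proof.
rewrite line_segment_image; apply: connected_continuous_connected.
  exact: segment_connected.
exact/continuous_subspaceT/continuous_line.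
Qed.

Lemma is_lineP l a b : is_line l -> l a -> l b -> a != b ->
  forall y, l y <-> cross (b - a) (y - a) = 0.
Proof.
move=> [p [u [u0 ->]]] [s _ <-] [t _ <-] ab y.
have st : t - s != 0 by apply: contraNneq ab => /subr0_eq ->.
have n0 := norm2_gt0 u0; split=> [[r _ <-]|].
  by rewrite /cross !coordE; ring.
move=> H; have cz : cross u (y - p) = 0.
  have : (t - s) * cross u (y - p) = 0.
    by rewrite -H /cross !coordE; ring.
  by move/eqP; rewrite mulf_eq0 (negbTE st) /= => /eqP.
exists (((y - p) ord0 ord0 * px u + py (y - p) * py u) / (px u ^+ 2 + py u ^+ 2)) => //.
rewrite -/(px (y - p)); move: cz n0; rewrite /cross !coordE => cz n0.
have n0' := lt0r_neq0 n0.
apply: plane_ext; rewrite !coordE; apply: (mulIf n0'); rewrite mulrDl mulrAC divfK //.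
  by rewrite -[RHS]addr0 -[in RHS](mulr0 (py u)) -cz; ring.
by rewrite -[RHS]addr0 -[in RHS](mulr0 (- px u)) -cz; ring.
Qed.

End Plane.

(** * Cells and edges *)

Section Tessellation.

Variable R : realType.
Local Notation V := 'rV[R]_2.
Variables (W : set V) (T : set (set V)).
Hypothesis PT : polygonal_tessellation W T.
Implicit Types (a b p u v w x y z : V) (c e f l s : set V).

Lemma cell_convex c : T c -> convex_set c.
Proof. by have [_ _ H _ _] := PT => /H[]. Qed.

Lemma cell_closed c : T c -> closed c.
Proof. by have [_ _ H _ _] := PT => /H[]. Qed.

Lemma cell_interior c : T c -> c° !=set0.
Proof. by have [_ _ H _ _] := PT => /H[]. Qed.

Lemma cell_sub c : T c -> c `<=` W.
Proof. by have [_ <- _ _ _] := PT => Tc z cz; exists c. Qed.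

Lemma cell_disjoint c c' z : T c -> T c' -> c° z -> c'° z -> c = c'.
Proof.
have [_ _ _ H _] := PT => Tc Tc' cz c'z; apply: contrapT => ne.
by have : (c° `&` c'°) z by []; rewrite (H c c').
Qed.

Lemma cell_meets_interior c c' z : T c -> T c' -> c° z -> c' z -> c = c'.
Proof.
move=> Tc Tc' cz c'z.
have nc : nbhs z c° by apply: nbhs_interior.
have [y c'y cy] := interior_dense (cell_convex Tc') (cell_interior Tc') c'z nc.
exact: cell_disjoint cy c'y.
Qed.

Lemma edge_not_interior e c z : edge T e -> T c -> e z -> ~ c° z.
Proof.
move=> [[c1 [c2 [T1 T2 ne ->]]] _] Tc [c1z c2z] cz; apply: ne.
by rewrite -(cell_meets_interior Tc T1 cz c1z) -(cell_meets_interior Tc T2 cz c2z).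
Qed.

Lemma edge_cells e : edge T e -> exists c c' a b,
  [/\ T c, T c', c <> c', a != b & e = c `&` c' /\ e = line_segment a b].
Proof.
move=> [[c [c' [Tc Tc' ne e1]]] [a [b [ab e2]]]]; exists c, c', a, b.
by split=> //; exact/eqP.
Qed.

(** The cells contain the triangles on [[a, b]] with apexes [w] and [w'], whose interiors overlap
    near the midpoint of the base. *)
Lemma cells_same_side c c' a b w w' : T c -> T c' -> a != b ->
  c a -> c b -> c' a -> c' b -> c w -> c' w' ->
  0 < cross (b - a) (w - a) * cross (b - a) (w' - a) -> c = c'.
Proof.
move=> Tc Tc' ab ca cb c'a c'b cw c'w' ww'.
have k0 : cross (b - a) (w - a) != 0.
  by apply: contraTneq ww' => ->; rewrite mul0r ltxx.
have k'0 : cross (b - a) (w' - a) != 0.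
  by apply: contraTneq ww' => ->; rewrite mulr0 ltxx.
have h01 : 0 < (2^-1 : R) < 1 by apply/andP; split; lra.
have N1 := near_side (cell_convex Tc) ca cb cw k0 h01.
have N2 := near_side (cell_convex Tc') c'a c'b c'w' k'0 h01.
have [d d0 H] := nbhs_dir (w - a) (filterI N1 N2).
have dd : `|d / 2| < d by rewrite gtr0_norm ?divr_gt0 // ltr_pdivrMr // ltr_pMr // ltr1n.
have := H _ dd; set y := a + _ + _ => -[/= H1 H2].
have ey : cross (b - a) (y - a) = d / 2 * cross (b - a) (w - a).
  by rewrite /y /cross !coordE; ring.
apply: (@cell_disjoint _ _ y) => //.
  by apply: H1; rewrite -/y ey mulrCA mulr_gt0 ?divr_gt0 // -expr2 exprn_even_gt0.
by apply: H2; rewrite -/y ey mulrCA mulr_gt0 ?divr_gt0 // mulrC.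
Qed.

Lemma edge_sides e c c' a b : T c -> T c' -> c <> c' -> a != b ->
  c a -> c b -> c' a -> c' b -> exists w w', [/\ c w, c' w' &
    cross (b - a) (w - a) * cross (b - a) (w' - a) < 0].
Proof.
move=> Tc Tc' ne ab ca cb c'a c'b.
have u0 : b - a != 0 by rewrite subr_eq0 eq_sym.
have [w cw k] := off_line a (cell_interior Tc) u0.
have [w' c'w' k'] := off_line a (cell_interior Tc') u0.
exists w, w'; split=> //; rewrite lt_neqAle mulf_neq0 //= leNgt; apply/negP => h.
exact/ne/(cells_same_side Tc Tc' ab ca cb c'a c'b cw c'w').
Qed.

(* Two distinct cells that share a segment lie on both sides of it. *)
Lemma near_edge c c' a b (t : R) : T c -> T c' -> c <> c' -> a != b ->
  c a -> c b -> c' a -> c' b -> 0 < t < 1 ->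
  nbhs (a + t *: (b - a)) [set y | (c y \/ c' y) /\
     (cross (b - a) (y - a) != 0 -> c° y \/ c'° y)].
Proof.
move=> Tc Tc' ne ab ca cb c'a c'b t01.
have [w [w' [cw c'w' ww']]] := edge_sides c Tc Tc' ne ab ca cb c'a c'b.
have k0 : cross (b - a) (w - a) != 0.
  by apply: contraTneq ww' => ->; rewrite mul0r ltxx.
have k'0 : cross (b - a) (w' - a) != 0.
  by apply: contraTneq ww' => ->; rewrite mulr0 ltxx.
have cc := cell_convex Tc; have cc' := cell_convex Tc'.
apply: filterS (filterI (filterI (near_triangle cc ca cb cw k0 t01)
  (near_triangle cc' c'a c'b c'w' k'0 t01))
  (filterI (near_side cc ca cb cw k0 t01) (near_side cc' c'a c'b c'w' k'0 t01))).
move=> y /= [[]]; set k := cross _ (w - a) in k0 ww' *; set k' := cross _ (w' - a) in k'0 ww' *.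
set r := cross _ (y - a) => H1 H2 [H3 H4]; split.
  have [kr|kr] := leP 0 (k * r); first by left; exact: H1.
  right; apply: H2; rewrite leNgt; apply/negP => k'r.
  have : 0 < (k * k') * r ^+ 2 by have := nmulr_rgt0 (k' * r) kr; nra.
  by rewrite ltNge mulr_le0_ge0 // ?sqr_ge0 // ltW.
move=> r0; have [kr|kr] := ltP 0 (k * r); first by left; exact: H3.
right; apply: H4; rewrite ltNge; apply/negP => k'r.
have r2 : 0 < r ^+ 2 by rewrite exprn_even_gt0.
have : 0 <= (k * k') * r ^+ 2.
  by rewrite (_ : _ * _ = (k * r) * (k' * r)); [exact: mulr_le0|ring].
by rewrite leNgt pmulr_llt0 // ww'.
Qed.

Lemma edge_interior_domain e a b (t : R) : edge T e -> e = line_segment a b -> a != b ->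
  0 < t < 1 -> W° (a + t *: (b - a)).
Proof.
move=> Ee eab ab t01; have [c [c' [a' [b' [Tc Tc' ne _ [ecc' _]]]]]] := edge_cells Ee.
have ea : e a by rewrite eab; exact: line_segment_l.
have eb : e b by rewrite eab; exact: line_segment_r.
move: ea eb; rewrite ecc' => -[ca c'a] [cb c'b].
apply: filterS (near_edge Tc Tc' ne ab ca cb c'a c'b t01) => y /= [[]] h _.
  exact: cell_sub h.
exact: cell_sub h.
Qed.

(** Near an inner point of [e], every point off its line is interior to a cell, and edges avoid the
    interiors of cells. *)
Lemma edge_transverse e f a b (t : R) y : edge T e -> e = line_segment a b -> a != b ->
  0 < t < 1 -> edge T f -> f (a + t *: (b - a)) -> f y -> cross (b - a) (y - a) = 0.
Proof.
move=> Ee eab ab t01 Ef fz fy.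
have [c [c' [_ [_ [Tc Tc' ne _ [ecc' _]]]]]] := edge_cells Ee.
have ea : e a by rewrite eab; exact: line_segment_l.
have eb : e b by rewrite eab; exact: line_segment_r.
move: ea eb; rewrite ecc' => -[ca c'a] [cb c'b].
apply/eqP/negPn/negP => k0; set z := a + t *: (b - a) in fz.
have [d d0 H] := nbhs_dir (y - z) (near_edge Tc Tc' ne ab ca cb c'a c'b t01).
pose r := Num.min (d / 2) 1.
have r0 : 0 < r by rewrite lt_min ltr01 andbT divr_gt0.
have r1 : r <= 1 by rewrite ge_min lexx orbT.
have rd : r < d by rewrite gt_min ltr_pdivrMr // ltr_pMr // ltr1n.
have fx : f (z + r *: (y - z)).
  have [_ [a' [b' [_ ef]]]] := Ef; rewrite ef in fz fy *.
  by apply: (line_segment_between fz fy); apply/line_segmentP; exists r; rewrite // ltW.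
have er : cross (b - a) (z + r *: (y - z) - a) = r * cross (b - a) (y - a).
  by rewrite /z /cross !coordE; ring.
have := H r; rewrite gtr0_norm // => /(_ rd)/= [_]; rewrite -/z er.
have rk : r * cross (b - a) (y - a) != 0 by rewrite mulf_neq0 // gt_eqF.
by move=> /(_ rk)[]; exact: edge_not_interior fx.
Qed.

(** On each side of [[a, b]] a single cell has it on its border, so both edges separate the same two
    cells, possibly in the other order. *)
Lemma edge_overlap e f a b : edge T e -> edge T f -> a != b ->
  e a -> e b -> f a -> f b -> e = f.
Proof.
move=> /edge_cells[c1 [c2 [_ [_ [T1 T2 ne _ [-> _]]]]]].
move=> /edge_cells[c3 [c4 [_ [_ [T3 T4 ne' _ [-> _]]]]]] ab [a1 a2] [b1 b2] [a3 a4] [b3 b4].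
have [w1 [w2 [cw1 cw2 k12]]] := edge_sides c1 T1 T2 ne ab a1 b1 a2 b2.
have [w3 [w4 [cw3 cw4 k34]]] := edge_sides c3 T3 T4 ne' ab a3 b3 a4 b4.
have same c c' w w' : T c -> T c' -> c a -> c b -> c' a -> c' b -> c w -> c' w' ->
  0 < cross (b - a) (w - a) * cross (b - a) (w' - a) -> c = c'.
  by move=> *; apply: (@cells_same_side c c' a b w w').
move: k12 k34; set k1 := cross _ (w1 - a); set k2 := cross _ (w2 - a).
set k3 := cross _ (w3 - a); set k4 := cross _ (w4 - a) => k12 k34.
have [k13|k13] := ltP 0 (k1 * k3).
  have k24 : 0 < k2 * k4 by nra.
  by rewrite (same c1 c3 w1 w3) // (same c2 c4 w2 w4).
have k10 : k1 != 0 by apply: contraTneq k12 => ->; rewrite mul0r ltxx.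
have k30 : k3 != 0 by apply: contraTneq k34 => ->; rewrite mul0r ltxx.
have {}k13 : k1 * k3 < 0 by rewrite lt_neqAle mulf_neq0.
have k14 : 0 < k1 * k4 by nra.
have k23 : 0 < k2 * k3 by nra.
by rewrite (same c1 c4 w1 w4) // (same c2 c3 w2 w3) // setIC.
Qed.

End Tessellation.

(** * Segments *)

Section SegmentGeometry.

Variable R : realType.
Local Notation V := 'rV[R]_2.
Implicit Types (a b p u v w x y z : V) (c e f l s : set V).

(** The left-to-right order of the sweep, with ties broken so that vertical lines are oriented
    too. *)
Definition lexlt a b := (px a < px b) || ((px a == px b) && (py a < py b)).

Lemma lexlt_irr a : lexlt a a = false.
Proof. by rewrite /lexlt !ltxx andbF. Qed.

Lemma lexlt_total a b : a != b -> lexlt a b || lexlt b a.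
Proof.
move=> ab; rewrite /lexlt; case: ltgtP => //= ex; case: ltgtP => //= ey.
by rewrite (plane_ext ex ey) eqxx in ab.
Qed.

Lemma lexlt_trans : transitive lexlt.
Proof.
move=> b a c; rewrite /lexlt => /orP[h1|/andP[/eqP e1 h1]] /orP[h2|/andP[/eqP e2 h2]].
- by rewrite (lt_trans h1 h2).
- by rewrite -e2 h1.
- by rewrite e1 h2.
- by rewrite e1 e2 eqxx (lt_trans h1 h2) orbT.
Qed.

Lemma lexlt_line p u (s t : R) : lexlt 0 u -> lexlt (p + s *: u) (p + t *: u) = (s < t).
Proof.
rewrite /lexlt !coordE => /orP[u0|/andP[/eqP u0 u1]].
  rewrite ltrD2l (inj_eq (addrI _)) ltr_pM2r // (inj_eq (mulIf (lt0r_neq0 u0))).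
  by case: ltgtP => //= ->; rewrite ltxx.
by rewrite -u0 !mulr0 ltxx eqxx /= ltrD2l ltr_pM2r.
Qed.

Lemma lexlt_sub a b : lexlt 0 (b - a) = lexlt a b.
Proof. by rewrite /lexlt !coordE !subr_gt0 [0 == _]eq_sym subr_eq0 [px b == _]eq_sym. Qed.

Lemma lexlt_segment a b (t : R) : lexlt a b ->
  (lexlt a (a + t *: (b - a)) = (0 < t)) * (lexlt (a + t *: (b - a)) b = (t < 1)).
Proof.
rewrite -lexlt_sub => ab; have e : a + 1 *: (b - a) = b by rewrite scale1r addrC subrK.
split; first by have := lexlt_line a 0 t ab; rewrite scale0r addr0.
by have := lexlt_line a t 1 ab; rewrite e.
Qed.

Lemma cross0_param a b y : a != b -> cross (b - a) (y - a) = 0 ->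
  exists t : R, y = a + t *: (b - a).
Proof.
move=> ab H.
have L : is_line [set a + t *: (b - a) | t in [set: R]].
  by exists a, (b - a); split=> //; rewrite subr_eq0 eq_sym.
have [||_ ] := @is_lineP _ _ a b L _ _ ab y.
- by exists 0 => //; rewrite scale0r addr0.
- by exists 1 => //; rewrite scale1r addrC subrK.
by move=> /(_ H)[t _ <-]; exists t.
Qed.

Lemma is_line_segment l x y : is_line l -> l x -> l y -> line_segment x y `<=` l.
Proof.
move=> [p [u [u0 ->]]] [s _ <-] [t _ <-] z /line_segmentP[r _ ->].
by exists (s + r * (t - s)) => //; apply: plane_ext; rewrite !coordE; ring.
Qed.

Lemma is_line_eq l l' a b : is_line l -> is_line l' -> l a -> l b -> l' a -> l' b ->
  a != b -> l = l'.
Proof.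
move=> L L' la lb l'a l'b ab; have H := is_lineP L la lb ab; have H' := is_lineP L' l'a l'b ab.
by apply/seteqP; split=> y; [move=> /H/H'|move=> /H'/H].
Qed.

(** Relative interior of a segment, in a form that names no ends and is monotone in [s]. *)
Definition strict s z := exists x y (t : R),
  [/\ s x, s y, x != y, 0 < t < 1 & z = x + t *: (y - x)].

Lemma strict_ends a b z : a != b -> line_segment a b z -> z != a -> z != b ->
  strict (line_segment a b) z.
Proof.
move=> ab /line_segmentP[t /andP[t0 t1] ->] za zb; exists a, b, t; split=> //.
- exact: line_segment_l.
- exact: line_segment_r.
rewrite !lt_neqAle t0 t1 !andbT; apply/andP; split.
  by apply: contraNneq za => <-; rewrite scale0r addr0.
by apply: contraNneq zb => ->; rewrite scale1r addrC subrK.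
Qed.

Lemma not_strict_l a b : ~ strict (line_segment a b) a.
Proof.
move=> [x [y [t []]]] /line_segmentP[r /andP[r0 r1] ->] /line_segmentP[s /andP[s0 s1] ->].
move=> xy /andP[t0 t1] e.
have [eab|ab] := eqVneq a b; first by rewrite eab subrr !scaler0 eqxx in xy.
have : (r + t * (s - r)) *: (b - a) = 0.
  apply: (@addrI _ a); rewrite addr0 [RHS]e.
  by apply: plane_ext; rewrite !coordE; ring.
move/eqP; rewrite scaler_eq0 subr_eq0 [b == a]eq_sym (negbTE ab) orbF => /eqP h.
have r00 : r = 0 by nra.
have s00 : s = 0 by nra.
by rewrite r00 s00 eqxx in xy.
Qed.

Lemma not_strict_r a b : ~ strict (line_segment a b) b.
Proof. by rewrite line_segment_sym; exact: not_strict_l. Qed.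

Lemma strict_mem s z : convex_set s -> strict s z -> s z.
Proof.
move=> cs [x [y [t [sx sy _ /andP[t0 t1] ->]]]].
by apply: (line_segment_sub cs sx sy); apply/line_segmentP; exists t; rewrite // !ltW.
Qed.

Lemma strict_sub s s' z : s `<=` s' -> strict s z -> strict s' z.
Proof. by move=> ss' [x [y [t [/ss' sx /ss' sy xy t01 e]]]]; exists x, y, t. Qed.

(** The coordinate [g] along the line attains its extrema by compactness and all values between them
    by connectedness. *)
Lemma line_compact_connected l s a0 b0 : is_line l -> s `<=` l -> compact s ->
  connected s -> a0 != b0 -> s a0 -> s b0 ->
  exists a b, lexlt a b /\ s = line_segment a b.
Proof.
move=> [p [u [u0 lE]]] sl cps cs ab0 sa0 sb0.
pose n := px u ^+ 2 + py u ^+ 2.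
have n0 : 0 < n by exact: norm2_gt0.
pose g y : R := ((px y - px p) * px u + (py y - py p) * py u) / n.
have gl (t : R) : g (p + t *: u) = t.
  by rewrite /g !coordE /n; field; exact: lt0r_neq0.
have lg y : s y -> y = p + g y *: u.
  by move=> /sl; rewrite lE => -[t _ <-]; rewrite gl.
have lgx y : s y -> px y = px p + g y * px u by move=> /lg {1}->; rewrite !coordE.
have lgy y : s y -> py y = py p + g y * py u by move=> /lg {1}->; rewrite !coordE.
have cg : continuous g.
  have cx : continuous (@px R) by exact: coord_continuous.
  have cy : continuous (@py R) by exact: coord_continuous.
  move=> y; apply: (@cvgMr_tmp _ _ (nbhs y)).
  apply: (@cvgD _ _ _ (nbhs y)); apply: (@cvgMr_tmp _ _ (nbhs y));
    apply: (@cvgB _ _ _ (nbhs y)); by [exact: cx|exact: cy|exact: cvg_cst].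
have s0 : s !=set0 by exists a0.
have cgs : {within s, continuous g} by exact: continuous_subspaceT.
have [a /set_mem sa amin] := compact_EVT_min s0 cps cgs.
have [b /set_mem sb bmax] := compact_EVT_max s0 cps cgs.
have ge y : s y -> g a <= g y <= g b.
  by move=> sy; rewrite amin ?bmax // inE.
have sab : s = line_segment a b.
  apply/seteqP; split=> y.
    move=> sy; have /andP[y1 y2] := ge y sy; apply/line_segmentP.
    have [eab'|nab] := eqVneq (g a) (g b).
      exists 0; first by rewrite lexx ler01.
      rewrite scale0r addr0 (lg _ sy) (lg _ sa); congr (_ + _ *: _); apply/eqP.
      by rewrite eq_le {1}eab' y1 y2.
    have d0 : 0 < g b - g a by rewrite subr_gt0 lt_neqAle nab (le_trans y1 y2).
    exists ((g y - g a) / (g b - g a)).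
      apply/andP; split; first by apply: divr_ge0; lra.
      by rewrite ler_pdivrMr //; lra.
    by apply: plane_ext; rewrite !coordE ?(lgx _ sy, lgx _ sa, lgx _ sb)
      ?(lgy _ sy, lgy _ sa, lgy _ sb); field; exact: lt0r_neq0.
  move=> /line_segmentP[t /andP[t0 t1] ->].
  have /connected_intervalP I : connected (g @` s).
    exact: connected_continuous_connected.
  have [|||z sz ez] := I (g a) (g b) _ _ (g a + t * (g b - g a)).
  - by exists a.
  - by exists b.
  - have /andP[_ ab] := ge a sa; apply/andP; split; nra.
  rewrite (_ : a + _ = z) //.
  by apply: plane_ext; rewrite !coordE ?(lgx _ sz, lgx _ sa, lgx _ sb)
    ?(lgy _ sz, lgy _ sa, lgy _ sb) ez; ring.
have ab : a != b.
  apply/negP => /eqP eab'; move/eqP: ab0; apply; rewrite (lg _ sa0) (lg _ sb0).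
  have := ge _ sa0; have := ge _ sb0; rewrite eab' => /andP[h1 h2] /andP[h3 h4].
  by congr (_ + _ *: _); apply/eqP; rewrite eq_le (le_trans h4 h1) (le_trans h2 h3).
case/orP: (lexlt_total ab) => h; first by exists a, b.
by exists b, a; rewrite line_segment_sym.
Qed.

End SegmentGeometry.

Section Segments.

Variable R : realType.
Local Notation V := 'rV[R]_2.
Variables (W : set V) (T : set (set V)).
Hypothesis PT : polygonal_tessellation W T.
Implicit Types (a b p u v w x y z : V) (c e f l s : set V).

Lemma finite_edges : finite_set (edge T).
Proof.
have [fT _ _ _ _] := PT.
apply: (sub_finite_set (B := [set cc.1 `&` cc.2 | cc in T `*` T])).
  by move=> e [[c [c' [Tc Tc' _ ->]]] _]; exists (c, c').
exact/finite_image/finite_setX.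
Qed.

Lemma edge_closed e : edge T e -> closed e.
Proof.
by move=> [[c [c' [Tc Tc' _ ->]]] _]; apply: closedI; exact: (cell_closed PT).
Qed.

Lemma edge_connected e : edge T e -> connected e.
Proof. by move=> [_ [a [b [_ ->]]]]; exact: line_segment_connected. Qed.

Lemma edge_sub e : edge T e -> e `<=` W.
Proof. by move=> [[c [c' [Tc _ _ ->]]] _] y [cy _]; exact: (cell_sub PT) cy. Qed.

Lemma edge_aligned_union e : edge T e -> aligned_contiguous_union T e.
Proof.
move=> Ee; have [_ [a [b [ab eab]]]] := Ee; exists [set e]; split.
- by move=> _ ->.
- by exists e.
- by rewrite bigcup_set1.
- exists [set a + t *: (b - a) | t in [set: R]]; split.
    by exists a, (b - a); split=> //; rewrite subr_eq0; apply/eqP => /esym.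
  by rewrite eab => y /line_segmentP[t _ ->]; exists t.
- exact: edge_connected.
Qed.

Lemma segment_exists e : edge T e -> exists2 s, segment T s & e `<=` s.
Proof.
move=> Ee; have [_ [a [b [/eqP ab eab]]]] := Ee.
have ea : e a by rewrite eab; exact: line_segment_l.
have eb : e b by rewrite eab; exact: line_segment_r.
(* All members of [F] contain [e], so they lie on its line and their union is connected: it is the
   largest member. *)
pose F := [set s | aligned_contiguous_union T s /\ e `<=` s].
pose s := \bigcup_(s' in F) s'.
have Fe : F e by split=> //; exact: edge_aligned_union.
have es : e `<=` s by move=> y ey; exists e.
have [_ [_ _ _ [l [L el]] _]] := edge_aligned_union Ee.
have Fl s' : F s' -> s' `<=` l.
  move=> [[_ [_ _ _ [l' [L' sl']] _]] es'].
  by rewrite (is_line_eq L L' (el _ ea) (el _ eb) (sl' _ (es' _ ea)) (sl' _ (es' _ eb)) ab).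
exists s => //; split; last first.
  move=> s' As' ss'; apply/seteqP; split=> // y s'y; exists s' => //; split=> //.
  exact: subset_trans es ss'.
exists [set f | edge T f /\ exists2 s', F s' & f `<=` s']; split.
- by move=> f [].
- by exists e; split=> //; exists e.
- apply/seteqP; split=> y.
    move=> [s' Fs' s'y]; have [[E [ET _ sE _ _]] _] := Fs'.
    move: (s'y); rewrite sE => -[f Ef fy]; exists f => //; split; first exact: ET.
    by exists s' => //; rewrite sE => x fx; exists f.
  by move=> [f [_ [s' Fs' fs']] fy]; exists s' => //; exact: fs'.
- by exists l; split=> // y [s' Fs' s'y]; exact: Fl s'y.
- apply: bigcup_connected; first by exists a => s' [_]; exact.
  by move=> s' [[E [_ _ _ _ ?]] _].
Qed.

Lemma segment_absorb s f l : segment T s -> edge T f -> is_line l -> s `<=` l -> f `<=` l ->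
  s `&` f !=set0 -> f `<=` s.
Proof.
move=> [[E [ET E0 sE _ cs]] max] Ef L sl fl sf.
have <- : s `|` f = s.
  apply: max; last exact: subsetUl.
  exists (E `|` [set f]); split.
  - by move=> g [/ET|->].
  - by case: E0 => g Eg; exists g; left.
  - by rewrite bigcup_setU bigcup_set1 -sE.
  - by exists l; split=> // y [/sl|/fl].
  - by apply: connectedU => //; exact: edge_connected.
exact: subsetUr.
Qed.

Lemma union_structure s : compact W -> aligned_contiguous_union T s ->
  exists a b, lexlt a b /\ s = line_segment a b.
Proof.
move=> cW [E [ET [e Ee] sE [l [L sl]] cs]].
have [_ [a0 [b0 [/eqP ab0 eab]]]] := ET _ Ee.
apply: (line_compact_connected L sl _ cs ab0).
- apply: (@subclosed_compact _ _ W) => //.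
    rewrite sE; apply: closed_bigcup; first exact: sub_finite_set finite_edges.
    by move=> f /ET; exact: edge_closed.
  by rewrite sE => y [f /ET Ef fy]; exact: edge_sub fy.
- by rewrite sE; exists e => //; rewrite eab; exact: line_segment_l.
- by rewrite sE; exists e => //; rewrite eab; exact: line_segment_r.
Qed.

End Segments.

Lemma ratio_itv (R : realFieldType) (q r : R) : 0 < q -> q <= r -> 0 <= q / r <= 1.
Proof.
move=> q0 qr; have r0 : 0 < r by lra.
by apply/andP; split; [apply: divr_ge0; lra|rewrite ler_pdivrMr // mul1r].
Qed.

(** * Edges at a point of a segment *)

Section LocalStructure.

Variable R : realType.
Local Notation V := 'rV[R]_2.
Variables (W : set V) (T : set (set V)).
Hypothesis PT : polygonal_tessellation W T.
Hypothesis cW : compact W.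
Implicit Types (a b p u v w x y z : V) (c e f l s : set V).

Lemma union_convex s : aligned_contiguous_union T s -> convex_set s.
Proof.
by case/(union_structure PT cW) => a [b [_ ->]]; exact: convex_line_segment.
Qed.

(* A point of [s] at which [s] continues in the direction [v] is on an edge that
   does so too, since the edges are finitely many and closed. *)
Lemma edge_towards s z v (r : R) : aligned_contiguous_union T s -> s z ->
  0 < r -> s (z + r *: v) ->
  exists e, [/\ edge T e, e `<=` s, e z & exists2 q, 0 < q & e (z + q *: v)].
Proof.
move=> As sz r0 sr; have [E [ET E0 sE _ _]] := As.
pose F := [set f | E f /\ ~ f z].
have cF : closed (\bigcup_(f in F) f).
  apply: closed_bigcup => [|f [/ET /(edge_closed PT)]//].
  by apply: sub_finite_set (finite_edges PT) => f [/ET].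
have nz : nbhs z (~` \bigcup_(f in F) f).
  by apply: open_nbhs_nbhs; split; [exact: closed_openC|move=> [f [_ nf] /nf]].
have [d d0 H] := nbhs_dir v nz.
pose q := Num.min (d / 2) r.
have q0 : 0 < q by rewrite lt_min r0 andbT divr_gt0.
have qr : q <= r by rewrite ge_min lexx orbT.
have qd : q < d by rewrite gt_min ltr_pdivrMr // ltr_pMr // ltr1n.
have sq : s (z + q *: v).
  apply: (line_segment_sub (union_convex As) sz sr); apply/line_segmentP.
  exists (q / r); first exact: ratio_itv.
  by apply: plane_ext; rewrite !coordE; field; exact: lt0r_neq0.
move: (sq); rewrite [in X in X -> _]sE => -[e Ee eq].
have ez : e z.
  by apply: contrapT => ne; apply: (H q); rewrite ?gtr0_norm //; exists e.
exists e; split=> //; first exact: ET; last by exists q.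
by rewrite sE => y ey; exists e.
Qed.

Lemma edge_end_or_strict e z : edge T e -> e z ->
  (exists2 x, z != x & e = line_segment z x) \/ strict e z.
Proof.
move=> [_ [a [b [/eqP ab ->]]]] ez.
have [->|za] := eqVneq z a; first by left; exists b.
have [->|zb] := eqVneq z b.
  by left; exists a; rewrite 1?eq_sym // line_segment_sym.
by right; exact: strict_ends.
Qed.

(** An edge of [s] leaves [z] in each of the two directions. If neither passes through [z], both end
    there, and they differ because an edge with end [z] leaves it in one direction only. *)
Lemma strict_local s z : aligned_contiguous_union T s -> strict s z ->
  (exists2 e, edge T e /\ e `<=` s & strict e z) \/
  (exists e f, [/\ e <> f, incident_edges T z e, incident_edges T z f, e `<=` s & f `<=` s]).
Proof.
move=> As [x [y [t [sx sy xy /andP[t0 t1] ez]]]].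
have sz : s z.
  by apply: (strict_mem (union_convex As)); exists x, y, t; rewrite ez t0 t1.
have [||e [Ee es ez' [q q0 eq]]] := @edge_towards s z (y - x) (1 - t) As sz; first lra.
  rewrite (_ : _ + _ = y) // ez; apply: plane_ext; rewrite !coordE; ring.
have [|f [Ef fs fz [q' q'0 fq]]] := @edge_towards s z (x - y) t As sz t0.
  rewrite (_ : _ + _ = x) // ez; apply: plane_ext; rewrite !coordE; ring.
have [[x1 zx1 ee]|] := edge_end_or_strict Ee ez'; last by left; exists e.
have [[x2 zx2 ef]|] := edge_end_or_strict Ef fz; last by left; exists f.
right; exists e, f; split=> //; last 2 first.
- by split=> //; exists x1; split=> //; exact/eqP.
- by split=> //; exists x2; split=> //; exact/eqP.
move=> eef; apply: (@not_strict_l _ z x1); rewrite -ee.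
exists (z + q *: (y - x)), (z + q' *: (x - y)), (q / (q + q')); split=> //.
- by rewrite eef.
- rewrite (inj_eq (addrI z)) -subr_eq0 (_ : _ - _ = (q + q') *: (y - x)).
    by rewrite scaler_eq0 negb_or gt_eqF ?addr_gt0 // subr_eq0 eq_sym.
  by apply: plane_ext; rewrite !coordE; ring.
- by rewrite divr_gt0 ?addr_gt0 //= ltr_pdivrMr ?addr_gt0 // mul1r ltrDl.
- apply: plane_ext; rewrite !coordE; field; rewrite gt_eqF ?addr_gt0 //.
Qed.

Lemma union_end_vertex a b : a != b -> aligned_contiguous_union T (line_segment a b) ->
  vertex T a.
Proof.
move=> ab As; have [|||e [Ee es ea _]] := @edge_towards _ a (b - a) 1 As.
- exact: line_segment_l.
- exact: ltr01.
- by rewrite scale1r addrC subrK; exact: line_segment_r.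
have [[x ax ee]|se] := edge_end_or_strict Ee ea.
  by exists e; split=> //; exists x; split=> //; exact/eqP.
by have := not_strict_l (strict_sub es se).
Qed.

Lemma aligned_segments_line s s' : segment T s -> segment T s' -> ~ aligned s s' ->
  forall a b, a != b -> s a -> s b -> s' a -> s' b -> False.
Proof.
move=> [[E [_ _ _ [l [L sl]] _]] _] [[E' [_ _ _ [l' [L' sl']] _]] _] nal a b ab sa sb s'a s'b.
apply: nal; exists l; split=> //.
by rewrite (is_line_eq L L' (sl _ sa) (sl _ sb) (sl' _ s'a) (sl' _ s'b) ab).
Qed.

Lemma degree_bound v n (e1 e2 e3 e4 : set V) : has_degree T v n ->
  [/\ incident_edges T v e1, incident_edges T v e2, incident_edges T v e3 &
      incident_edges T v e4] ->
  [/\ e1 <> e2, e1 <> e3, e1 <> e4 & [/\ e2 <> e3, e2 <> e4 & e3 <> e4]] -> (3 < n)%N.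
Proof.
rewrite /has_degree card_eq_le => /andP[/pcard_leP[f] _] [i1 i2 i3 i4] [n12 n13 n14 [n23 n24 n34]].
have fn e : incident_edges T v e -> (f e < n)%N by move=> ie; exact: (@funS _ _ _ _ f e ie).
have fi e e' : incident_edges T v e -> incident_edges T v e' -> e <> e' -> f e <> f e'.
  by move=> ie ie' ne fe; apply: ne; apply: (inj (f := f)); rewrite ?inE.
have := fi _ _ i1 i2 n12; have := fi _ _ i1 i3 n13; have := fi _ _ i1 i4 n14.
have := fi _ _ i2 i3 n23; have := fi _ _ i2 i4 n24; have := fi _ _ i3 i4 n34.
have := fn _ i1; have := fn _ i2; have := fn _ i3; have := fn _ i4.
move: (f e1) (f e2) (f e3) (f e4) => *; lia.
Qed.

(** In the same direction from [z] the two edges would overlap and be equal, so they leave [z] in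
    opposite directions. *)
Lemma incident_edge_line l z e : is_line l -> incident_edges T z e -> e `<=` l ->
  forall e', incident_edges T z e' -> e' `<=` l -> e <> e' ->
  exists x y, [/\ e x, e' y & strict (line_segment x y) z].
Proof.
move=> L [Ee [x [/eqP zx ee]]] el e' [Ee' [y [/eqP zy ee']]] el' ne.
have ez : e z by rewrite ee; exact: line_segment_l.
have ex : e x by rewrite ee; exact: line_segment_r.
have ez' : e' z by rewrite ee'; exact: line_segment_l.
have ey' : e' y by rewrite ee'; exact: line_segment_r.
have /(is_lineP L (el _ ez) (el _ ex) zx)/(cross0_param zx)[r er] : l y by exact: el'.
have r0 : r != 0 by apply: contraNneq zy => r0; rewrite er r0 scale0r addr0.
have [rpos|rneg] := ltP 0 r.
  pose q := Num.min r 1.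
  have q0 : 0 < q by rewrite lt_min rpos ltr01.
  have qr : q <= r by rewrite ge_min lexx.
  have q1 : q <= 1 by rewrite ge_min lexx orbT.
  exfalso; apply: ne; apply: (edge_overlap PT (a := z) (b := z + q *: (x - z))) => //.
  - rewrite -subr_eq0 opprD addrA subrr add0r oppr_eq0 scaler_eq0 negb_or gt_eqF //.
    by rewrite subr_eq0 eq_sym.
  - by rewrite ee; apply/line_segmentP; exists q; rewrite // ltW.
  - rewrite ee'; apply/line_segmentP; exists (q / r); first exact: ratio_itv.
    by rewrite er; apply: plane_ext; rewrite !coordE; field.
have {}rneg : r < 0 by rewrite lt_neqAle r0.
exists x, y; split=> //; exists x, y, (1 - r)^-1; split.
- exact: line_segment_l.
- exact: line_segment_r.
- apply: contraTneq rneg => exy; rewrite -leNgt.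
  have : (r - 1) *: (x - z) = y - x.
    by rewrite er; apply: plane_ext; rewrite !coordE; ring.
  rewrite -exy subrr.
  by move/eqP; rewrite scaler_eq0 !subr_eq0 [x == z]eq_sym (negbTE zx) orbF => /eqP ->.
- by apply/andP; split; [rewrite invr_gt0; lra|rewrite invf_lt1; lra].
- by rewrite er; apply: plane_ext; rewrite !coordE; field; rewrite gt_eqF //; lra.
Qed.

End LocalStructure.

Section TTessellation.

Variable R : realType.
Local Notation V := 'rV[R]_2.
Variables (W : set V) (T : set (set V)).
Hypothesis TT : T_tessellation W T.
Hypothesis cW : compact W.
Implicit Types (a b p u v w x y z : V) (c e f l s : set V).

Let PT : polygonal_tessellation W T. Proof. by case: TT. Qed.

Lemma segments_aligned_eq s s' a b : segment T s -> segment T s' -> a != b ->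
  s a -> s b -> s' a -> s' b -> s = s'.
Proof.
move=> Ss Ss' ab sa sb s'a s'b; apply: contrapT => ne; have [_ _ H] := TT.
exact: (aligned_segments_line Ss Ss' (H _ _ Ss Ss' ne) ab).
Qed.

(* A common inner point would be a vertex with four incident edges. *)
Lemma segment_not_crossing s s' z : segment T s -> segment T s' ->
  strict s z -> strict s' z -> s = s'.
Proof.
move=> Ss Ss' sz s'z; have [As _] := Ss; have [As' _] := Ss'.
(* If an edge of [f] passes through [z], then by [edge_transverse] an edge of [g] at [z] is on the
   same line; [f] absorbs it, and [f] and [g] share two points. *)
have through f g : segment T f -> segment T g -> strict f z -> strict g z ->
    (exists2 e, edge T e /\ e `<=` f & strict e z) -> f = g.
  move=> Sf Sg fz gz [e [Ee ef] ez]; have [_ [a [b [/eqP ab eab]]]] := Ee.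
  move: ez; rewrite eab => -[x [y [t [ex ey xy t01 ezt]]]].
  have [h [Eh hz hg]] : exists h, [/\ edge T h, h z & h `<=` g].
    have [[h [Eh hg] hz]|[h [_ [_ [Eh [x1 [_ hx1]]] _ hg _]]]] := strict_local PT cW Sg.1 gz.
      exists h; split=> //; have [_ [? [? [_ hE]]]] := Eh; rewrite hE in hz *.
      by case: hz => a1 [b1 [t1 [h1 h2 _ /andP[h3 h4] ->]]];
        apply: (line_segment_between h1 h2); apply/line_segmentP; exists t1; rewrite // !ltW.
    by exists h; split=> //; rewrite hx1; exact: line_segment_l.
  have [_ [a1 [b1 [/eqP ab1 hab]]]] := Eh.
  have ea : e a by rewrite eab; exact: line_segment_l.
  have eb : e b by rewrite eab; exact: line_segment_r.
  have ha : h a1 by rewrite hab; exact: line_segment_l.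
  have hb : h b1 by rewrite hab; exact: line_segment_r.
  have [t' t'01 ezt'] : exists2 t' : R, 0 < t' < 1 & z = a + t' *: (b - a).
    move/line_segmentP: ex => [r /andP[r0 r1] exr]; move/line_segmentP: ey => [q /andP[q0 q1] eyq].
    move/andP: t01 => [t0 t1].
    have rq : r != q by apply: contraNneq xy => rq; rewrite exr eyq rq.
    exists (r + t * (q - r)).
      by case: (ltgtP r q) rq => // rq _; apply/andP; split; nra.
    by rewrite ezt exr eyq; apply: plane_ext; rewrite !coordE; ring.
  have cr w : h w -> cross (b - a) (w - a) = 0.
    by apply: (edge_transverse PT Ee eab ab t'01 Eh); rewrite -ezt'.
  have [E [_ _ _ [l [L fl]] _]] := Sf.1.
  have la := fl _ (ef _ ea); have lb := fl _ (ef _ eb).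
  have hl : h `<=` l by move=> w /cr/(is_lineP L la lb ab).
  have hf : h `<=` f.
    apply: (segment_absorb Sf Eh L fl hl); exists z; split=> //.
    by apply: strict_mem fz; exact: (union_convex PT cW Sf.1).
  by apply: (segments_aligned_eq Sf Sg ab1); [exact: hf|exact: hf|exact: hg|exact: hg].
have [H|[e1 [e2 [n12 i1 i2 e1s e2s]]]] := strict_local PT cW As sz; first exact: through H.
have [H|[f1 [f2 [m12 j1 j2 f1s f2s]]]] := strict_local PT cW As' s'z.
  exact/esym/(through _ _ Ss' Ss s'z sz).
apply: contrapT => ne.
have dist e f : edge T e -> e `<=` s -> f `<=` s' -> e <> f.
  move=> [_ [a [b [/eqP ab eab]]]] es fs' ef; apply: ne.
  have ea : e a by rewrite eab; exact: line_segment_l.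
  have eb : e b by rewrite eab; exact: line_segment_r.
  by apply: (segments_aligned_eq Ss Ss' ab); rewrite ?ef //; [exact: es|exact: es|
    apply: fs'; rewrite -ef|apply: fs'; rewrite -ef].
have vz : vertex T z by exists e1.
have [_ /(_ z vz) Tz _] := TT.
have D n : has_degree T z n -> (3 < n)%N.
  move=> Dn; apply: (degree_bound Dn (And4 i1 i2 j1 j2)).
  by case: i1 i2 => E1 _ [E2 _]; split; [|exact: dist|exact: dist|split; [exact: dist|exact: dist|]].
by case: Tz => -[/D].
Qed.

(** The end is a vertex, hence T-shaped. With degree one it is on the boundary; with degree three,
    its two aligned edges lie on one segment that passes through [a], which [s] does not. *)
Lemma segment_end s a b : segment T s -> a != b -> s = line_segment a b ->
  boundary W a \/ exists2 s', segment T s' & s' <> s /\ strict s' a.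
Proof.
move=> Ss ab sab; have [As _] := Ss; rewrite sab in As.
have va := union_end_vertex PT cW ab As.
have [_ /(_ a va)[[_ [e [e' [ie ie' ne [l [L el el']]]]]]|[_ Wa]] _] := TT; last by left.
right; have [s' Ss' es'] := segment_exists ie.1.
have [x [y [ex ey st]]] := incident_edge_line PT L ie el ie' el' ne.
exists s' => //.
suff sa : strict s' a.
  by split=> // ess; apply: (@not_strict_l _ a b); rewrite -sab -ess.
have ea : e a by have [_ [? [_ ->]]] := ie; exact: line_segment_l.
have ea' : e' a by have [_ [? [_ ->]]] := ie'; exact: line_segment_l.
have [_ [x' [/eqP ax' ee]]] := ie.
have ex' : e x' by rewrite ee; exact: line_segment_r.
have [E [_ _ _ [l' [L' s'l']] _]] := Ss'.1.
have ll' := is_line_eq L L' (el _ ea) (el _ ex') (s'l' _ (es' _ ea)) (s'l' _ (es' _ ex')) ax'.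
have e's' : e' `<=` s'.
  by apply: (segment_absorb Ss' ie'.1 L' s'l'); [rewrite -ll'|exists a; split=> //; exact: es'].
apply: strict_sub st; apply: line_segment_sub (union_convex PT cW Ss'.1) (es' _ ex) (e's' _ ey).
Qed.

End TTessellation.

(** * From tessellations to configurations *)

Section Determination.

Variable R : realType.
Local Notation V := 'rV[R]_2.
Variable W : set V.
Implicit Types (T : set (set V)) (a b p u v w x y z : V) (c e f l s : set V).

Lemma segment_meets_boundary c x y : closed c -> c° x -> ~ c y ->
  exists z, [/\ line_segment x y z, c z & ~ c° z].
Proof.
move=> cc cx cy; apply: contrapT => H.
have sep : separated c° (~` c).
  rewrite /separated; split.
    apply/seteqP; split=> // z [cz nz]; apply: nz.
    by rewrite (closure_id c).1 //; exact: (closureS (@interior_subset _ c)) cz.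
  by apply/seteqP; split=> // z [cz]; rewrite closure_setC.
have sub : line_segment x y `<=` c° `|` ~` c.
  move=> z sz; have [cz|ncz] := EM (c z); last by right.
  by left; apply: contrapT => nz; apply: H; exists z.
case: (connected_subset sep sub (@line_segment_connected _ x y)) => h.
  by apply: cy; apply: interior_subset; apply: h; exact: line_segment_r.
by apply: (h x (@line_segment_l _ x y)); exact: interior_subset.
Qed.

(** Otherwise a path inside the interior of [c'] leaves [c] at a point of its boundary. That point
    is on an edge of [T], hence of [T'], or on the boundary of [W], and neither meets the interior
    of [c']. *)
Lemma cell_grows T T' c c' x : polygonal_tessellation W T -> polygonal_tessellation W T' ->
  \bigcup_(e in edge T) e `<=` \bigcup_(e in edge T') e ->
  T c -> T' c' -> c° x -> c'° x -> c' `<=` c.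
Proof.
move=> PT PT' U Tc Tc' cx c'x.
have cc := cell_closed PT Tc; have vc' := cell_convex PT' Tc'.
suff int : c'° `<=` c.
  move=> y c'y; rewrite (closure_id c).1 // => O nO.
  have [z c'z Oz] := interior_dense vc' (cell_interior PT' Tc') c'y nO.
  by exists z; split=> //; exact: int.
move=> y c'y; apply: contrapT => ncy.
have [z [xyz cz ncz]] := segment_meets_boundary cc cx ncy.
have c'z : c'° z.
  move: xyz => /line_segmentP[t /andP[t0 t1] ->].
  have [->|tn1] := eqVneq t 1; first by rewrite scale1r addrC subrK.
  rewrite (_ : _ + _ = (1 - t) *: x + t *: y).
    apply: interior_convex => //; first exact: interior_subset.
    by rewrite t0 lt_neqAle tn1.
  by apply: plane_ext; rewrite !coordE; ring.
have [_ _ _ _ /(_ _ Tc)[E [P [_ ET PW bE]]]] := PT.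
have : boundary c z by split=> //; exact: subset_closure.
rewrite bE => -[[e /ET Ee ez]|/PW[_]].
  have [e' Ee' e'z] := U z (ex_intro2 _ _ e Ee ez).
  exact: (edge_not_interior PT' Ee' Tc' e'z).
by apply; exact: (interiorS (cell_sub PT' Tc')).
Qed.

Lemma cells_determined T T' : polygonal_tessellation W T -> polygonal_tessellation W T' ->
  \bigcup_(e in edge T) e = \bigcup_(e in edge T') e -> T `<=` T'.
Proof.
move=> PT PT' U c Tc; have [x cx] := cell_interior PT Tc.
have : W x by apply: (cell_sub PT Tc); exact: interior_subset.
have [_ <- _ _ _] := PT' => -[c' Tc' c'x].
have nc : nbhs x c° by exact: nbhs_interior.
have [z c'z cz] := interior_dense (cell_convex PT' Tc') (cell_interior PT' Tc') c'x nc.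
suff -> : c = c' by [].
apply/seteqP; split.
  by apply: (cell_grows PT' PT _ Tc' Tc c'z cz); rewrite U.
by apply: (cell_grows PT PT' _ Tc Tc' cz c'z); rewrite U.
Qed.

Lemma tessellation_determined T T' : polygonal_tessellation W T -> polygonal_tessellation W T' ->
  \bigcup_(e in edge T) e = \bigcup_(e in edge T') e -> T = T'.
Proof.
by move=> PT PT' U; apply/seteqP; split; [exact: cells_determined|exact: cells_determined PT' PT (esym U)].
Qed.

End Determination.

(** * The chord that a line cuts in the domain *)

Section Chords.

Variable R : realType.
Local Notation V := 'rV[R]_2.
Variable W : set V.
Hypothesis PW : planar_domain W.
Implicit Types (T : set (set V)) (a b p u v w x y z : V) (c e f l s : set V).

Lemma convex_connected c : convex_set c -> connected c.
Proof.
move=> cc; have [[x cx]|/nonemptyPn->] := pselect (c !=set0); last exact: connected0.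
rewrite (_ : c = \bigcup_(y in c) line_segment x y).
  apply: bigcup_connected; last by move=> y _; exact: line_segment_connected.
  by exists x => y _; exact: line_segment_l.
apply/seteqP; split=> [y cy|y [z cz]]; first by exists y => //; exact: line_segment_r.
exact: line_segment_sub.
Qed.

Lemma convex_line l : is_line l -> convex_set l.
Proof.
move=> L; apply/convex_setW => x y; rewrite !inE => lx ly k _ _.
apply/mem_set/(is_line_segment L ly lx)/line_segmentP; exists k%:num.
  by apply/andP; split.
by apply: plane_ext; rewrite /conv /= /unstable.onem !coordE; ring.
Qed.

Lemma closed_line l : is_line l -> closed l.
Proof.
move=> [p [u [u0 ->]]].
have L : is_line [set p + t *: u | t in [set: R]] by exists p, u.
have l0 : [set p + t *: u | t in [set: R]] p by exists 0; rewrite // scale0r addr0.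
have l1 : [set p + t *: u | t in [set: R]] (p + u) by exists 1; rewrite // scale1r.
have pu : p != p + u by rewrite -subr_eq0 opprD addrA subrr add0r oppr_eq0.
have H := is_lineP L l0 l1 pu.
rewrite (_ : [set p + t *: u | t in [set: R]] = ~` [set y | 0 < 0 + cross u (y - p)] `&`
  ~` [set y | 0 < 0 + cross (- u) (y - p)]); last first.
  have e y : cross (p + u - p) (y - p) = cross u (y - p) by rewrite /cross !coordE; ring.
  have e' y : cross (- u) (y - p) = - cross u (y - p) by rewrite /cross !coordE; ring.
  apply/seteqP; split=> y.
    by move/H; rewrite e => h; split; rewrite /= ?e' add0r h ?oppr0 ltxx.
  case=> /=; rewrite !add0r e' => /negP h1 /negP h2; apply/H; rewrite e; lra.
by apply: closedI; apply: open_closedC; rewrite openE => y /= /nbhs_cross_gt0.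
Qed.

Lemma interior_strict z z0 x : W° z0 -> W x -> strict (line_segment z0 x) z -> W° z.
Proof.
have [_ cW _] := PW => W0 Wx sz.
have := strict_mem (@convex_line_segment _ z0 x) sz.
case/line_segmentP => t /andP[t0 t1] ez.
have tn1 : t != 1.
  apply: contraPneq sz => t1'; rewrite ez t1' scale1r addrC subrK; exact: not_strict_r.
rewrite ez (_ : _ + _ = (1 - t) *: z0 + t *: x).
  by apply: interior_convex => //; rewrite t0 lt_neqAle tn1.
by apply: plane_ext; rewrite !coordE; ring.
Qed.

Definition is_chord l (ab : V * V) := [/\ lexlt ab.1 ab.2, l `&` W = line_segment ab.1 ab.2 &
  forall z, l z -> boundary W z <-> z = ab.1 \/ z = ab.2].

(** The interior point excludes lines along a side of [W], where the whole chord is on the boundary.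
    By convexity, every point of the chord but its ends is interior. *)
Lemma chord_exists l z0 : is_line l -> l z0 -> W° z0 -> exists ab, is_chord l ab.
Proof.
have [cpW cW _] := PW => L lz0 Wz0.
have clW : closed W by apply: compact_closed => //; exact: norm_hausdorff.
have [p [u [u0 lE]]] := L.
have [d d0 H] := nbhs_dir u Wz0.
have dd : `|d / 2| < d by rewrite gtr0_norm ?divr_gt0 // ltr_pdivrMr // ltr_pMr // ltr1n.
have lu (t : R) : l (z0 + t *: u).
  move: lz0; rewrite lE => -[s _ <-]; exists (s + t) => //.
  by rewrite scalerDl addrA.
have Iconv : convex_set (l `&` W).
  apply/convex_setW => x y; rewrite !inE => -[lx Wx] [ly Wy] k _ _; apply/mem_set; split.
    have := @convex_line l L x y k; rewrite !inE; exact.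
  have := cW x y k; rewrite !inE; exact.
have [||||||a [b [ab eab]]] := @line_compact_connected R l (l `&` W) z0 (z0 + (d / 2) *: u) L.
- by move=> ? [].
- by rewrite setIC; apply: compact_closedI => //; exact: closed_line.
- exact: convex_connected.
- rewrite -subr_eq0 opprD addrA subrr add0r oppr_eq0 scaler_eq0 negb_or u0 andbT.
  by rewrite gt_eqF // divr_gt0.
- by split=> //; exact: interior_subset.
- by split=> //; exact: H.
exists (a, b); split=> //= z lz.
have ab' : a != b by apply: contraTneq ab => ->; rewrite lexlt_irr.
have [la Wa] : (l `&` W) a by rewrite eab; exact: line_segment_l.
have [lb Wb] : (l `&` W) b by rewrite eab; exact: line_segment_r.
split.
  move=> [clz nWz]; have Wz : W z by rewrite (closure_id W).1.
  apply: contrapT => /not_orP[/eqP za /eqP zb]; apply: nWz.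
  have zz0 : z = z0 \/ z != z0 by case: eqVneq => ?; [left|right].
  case: zz0 => [->//|zz0].
  have [x Wx sx] : exists2 x, W x & strict (line_segment z0 x) z.
    have abz : line_segment a b z by rewrite -eab.
    have abz0 : line_segment a b z0 by rewrite -eab; split=> //; exact: interior_subset.
    case/line_segmentP: abz => r /andP[r0 r1] er; case/line_segmentP: abz0 => q /andP[q0 q1] eq.
    have rq : r != q by apply: contraNneq zz0 => rq; rewrite er eq rq.
    have rn0 : r != 0 by apply: contraNneq za => rn; rewrite er rn scale0r addr0.
    have rn1 : r != 1 by apply: contraNneq zb => rn; rewrite er rn scale1r addrC subrK.
    have r0' : 0 < r by rewrite lt_neqAle eq_sym rn0.
    have r1' : r < 1 by rewrite lt_neqAle rn1.
    have [rq'|rq'] := ltP r q.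
      exists a => //; apply: strict_ends => //.
      - apply: contraTneq rq' => z0a; rewrite -leNgt.
        suff -> : q = 0 by exact: ltW.
        by apply: (segment_param_inj ab'); rewrite -eq scale0r addr0.
      - apply/line_segmentP; exists ((q - r) / q).
          by apply: ratio_itv; lra.
        by rewrite eq er; apply: plane_ext; rewrite !coordE; field; rewrite gt_eqF //; lra.
    have {rq' rq}rq : q < r by rewrite lt_neqAle eq_sym rq.
    exists b => //; apply: strict_ends => //.
    - apply: contraTneq rq => z0b; rewrite -leNgt.
      suff -> : q = 1 by exact: ltW.
      by apply: (segment_param_inj ab'); rewrite -eq scale1r addrC subrK.
    - apply/line_segmentP; exists ((r - q) / (1 - q)).
        by apply: ratio_itv; lra.
      by rewrite eq er; apply: plane_ext; rewrite !coordE; field; rewrite gt_eqF //; lra.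
  exact: interior_strict Wz0 Wx sx.
have aux x y : l `&` W = line_segment x y -> x != y -> ~ W° x.
  move=> exy xy Wx; have [r r0 Hr] := nbhs_dir (x - y) Wx.
  have rr : `|r / 2| < r by rewrite gtr0_norm ?divr_gt0 // ltr_pdivrMr // ltr_pMr // ltr1n.
  have [lx _] : (l `&` W) x by rewrite exy; exact: line_segment_l.
  have [ly _] : (l `&` W) y by rewrite exy; exact: line_segment_r.
  apply: (@not_strict_l _ x y); exists (x + (r / 2) *: (x - y)), y, ((r / 2) / (1 + r / 2)); split.
  - rewrite -exy; split; last exact: Hr.
    by apply/(is_lineP L lx ly xy); rewrite /cross !coordE; ring.
  - exact: line_segment_r.
  - rewrite -subr_eq0 (_ : _ - _ = (1 + r / 2) *: (x - y)); last first.
      by apply: plane_ext; rewrite !coordE; ring.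
    by rewrite scaler_eq0 subr_eq0 (negbTE xy) orbF gt_eqF //; lra.
  - apply/andP; split; first by apply: divr_gt0; lra.
    by rewrite ltr_pdivrMr; lra.
  - by apply: plane_ext; rewrite !coordE; field; rewrite gt_eqF //; lra.
case=> ->; split; try exact: subset_closure.
  exact: aux ab'.
by apply: (aux b a); rewrite 1?eq_sym // line_segment_sym.
Qed.

End Chords.

Lemma count_lt (T : eqType) (p1 p2 : pred T) (s : seq T) x :
  subpred p1 p2 -> x \in s -> p2 x -> ~~ p1 x -> (count p1 s < count p2 s)%N.
Proof.
move=> sub; elim: s => // y s IHs; rewrite inE => /orP[/eqP <-|xs] p2x np1x /=.
  by rewrite p2x (negbTE np1x) add0n add1n ltnS sub_count.
by rewrite -addnS leq_add ?IHs //; case: (p1 y) (sub y) => //= ->.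
Qed.

Section SegmentOrder.

Variable R : realType.
Local Notation V := 'rV[R]_2.
Implicit Types (a b z : V) (l : set V).

Lemma lexlt_neq a b : lexlt a b -> a != b.
Proof. by apply: contraTneq => ->; rewrite lexlt_irr. Qed.

Lemma segment_lex a b z : lexlt a b -> line_segment a b z ->
  (z = a \/ lexlt a z) /\ (z = b \/ lexlt z b).
Proof.
move=> ab /line_segmentP[t /andP[t0 t1] ->]; rewrite !lexlt_segment //; split.
  have [->|tn0] := eqVneq t 0; first by left; rewrite scale0r addr0.
  by right; rewrite lt_neqAle eq_sym tn0.
have [->|tn1] := eqVneq t 1; first by left; rewrite scale1r addrC subrK.
by right; rewrite lt_neqAle tn1.
Qed.

Lemma strict_lex a b z : lexlt a b -> strict (line_segment a b) z ->
  lexlt a z /\ lexlt z b.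
Proof.
move=> ab sz; have [h1 h2] := segment_lex ab (strict_mem (@convex_line_segment _ a b) sz).
split.
  by case: h1 => // za; case: (@not_strict_l _ a b); rewrite -[X in strict _ X]za.
by case: h2 => // zb; case: (@not_strict_r _ a b); rewrite -[X in strict _ X]zb.
Qed.

Lemma lex_strict l a b z : is_line l -> l a -> l b -> l z -> lexlt a z -> lexlt z b ->
  strict (line_segment a b) z.
Proof.
move=> L la lb lz az zb; have ab := lexlt_trans az zb.
have nab := lexlt_neq ab.
have /(cross0_param nab)[t et] : cross (b - a) (z - a) = 0 by apply/(is_lineP L la lb nab).
move: az zb; rewrite et !lexlt_segment // => t0 t1.
exists a, b, t; split=> //; [exact: line_segment_l|exact: line_segment_r|exact/andP].
Qed.

End SegmentOrder.

(** * Numbering of the points and the configuration of a tessellation *)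

Section Counting.

Variable R : realType.
Local Notation V := 'rV[R]_2.
Variables (W : set V) (k : nat) (ln : 'I_k -> set V).
Hypothesis PW : planar_domain W.
Hypothesis ln_line : forall i, is_line (ln i).
Hypothesis ln_inj : injective ln.
Hypothesis ln_meets : forall i, exists z, ln i z /\ W° z.
Implicit Types (T : set (set V)) (a b z : V) (i j : 'I_k).

Let L := [set ln i | i in [set: 'I_k]].

Let cW : compact W. Proof. by case: PW. Qed.

Let chord_ex i : exists ab, is_chord W (ln i) ab.
Proof. by have [z [lz Wz]] := ln_meets i; exact: chord_exists lz Wz. Qed.

Let ch : 'I_k -> V * V := projT1 (choice chord_ex).
Let chP i : is_chord W (ln i) (ch i). Proof. exact: (projT2 (choice chord_ex)). Qed.

(** Stated so that a point can be chosen for every pair; it is arbitrary for lines that do not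
    meet. *)
Let meet_ex (ij : 'I_k * 'I_k) : exists z,
  forall z', ln ij.1 z' -> ln ij.2 z' -> ln ij.1 z /\ ln ij.2 z.
Proof.
have [[z [h1 h2]]|nz] := pselect (exists z, ln ij.1 z /\ ln ij.2 z); first by exists z.
by exists 0 => z' h1 h2; case: nz; exists z'.
Qed.

Let pt : 'I_k * 'I_k -> V := projT1 (choice meet_ex).

Lemma lines_meet_once i j z z' : i != j -> ln i z -> ln j z -> ln i z' -> ln j z' -> z = z'.
Proof.
move=> ij iz jz iz' jz'; apply/eqP/negPn/negP => ne.
have := is_line_eq (ln_line i) (ln_line j) iz iz' jz jz' ne.
by move/ln_inj => e; rewrite e eqxx in ij.
Qed.

Let ptP i j z : i != j -> ln i z -> ln j z -> z = pt (i, j).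
Proof.
move=> ij iz jz; have [h1 h2] := projT2 (choice meet_ex) (i, j) z iz jz.
exact: lines_meet_once jz h1 h2.
Qed.

(** Contains all ends of segments, each being a chord end or a meeting point of two lines. Points
    outside [W] are sorted out by [inc]. *)
Let Q : seq V := [seq (ch i).1 | i : 'I_k] ++ [seq (ch i).2 | i : 'I_k] ++
  [seq pt ij | ij : 'I_k * 'I_k].

(* Lexicographic order is monotone along every line, hence so is the rank in it. *)
Let nu z := count (fun q => lexlt q z) Q.
Let N := (size Q).+1.

Let nuN z : (nu z < N)%N. Proof. by rewrite ltnS count_size. Qed.

Let nu_lt q z : q \in Q -> lexlt q z -> (nu q < nu z)%N.
Proof.
move=> qQ qz; apply: (count_lt (x := q)) => //; last by rewrite lexlt_irr.
by move=> x xq; exact: lexlt_trans qz.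
Qed.

Let nu_inj q q' : q \in Q -> q' \in Q -> nu q = nu q' -> q = q'.
Proof.
move=> qQ q'Q e; apply/eqP/negPn/negP => /lexlt_total/orP[]/nu_lt; rewrite e ltnn.
  by move/(_ qQ).
by move/(_ q'Q).
Qed.

Let lt_nu q z : q \in Q -> z \in Q -> (nu q < nu z)%N -> lexlt q z.
Proof.
move=> qQ zQ lt; have : q != z by apply: contraTneq lt => ->; rewrite ltnn.
by case/lexlt_total/orP => // /(nu_lt zQ); rewrite ltnNge ltnW.
Qed.

Let inc i (n : nat) : bool := `[< exists z, [/\ z \in Q, ln i z, W z & nu z = n] >].

Let point (z : V) : 'I_N := inord (nu z).

Let pointE z : point z = nu z :> nat. Proof. by rewrite /point inordK // nuN. Qed.

Let al i := point (ch i).1.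
Let be i := point (ch i).2.

Let ch1Q i : (ch i).1 \in Q.
Proof. by rewrite !mem_cat fintype.image_f. Qed.

Let ch2Q i : (ch i).2 \in Q.
Proof. by rewrite !mem_cat fintype.image_f ?orbT. Qed.

Let ptQ ij : pt ij \in Q.
Proof. by rewrite !mem_cat fintype.image_f ?orbT. Qed.

Let ch_in i : (ln i `&` W) (ch i).1 /\ (ln i `&` W) (ch i).2.
Proof.
by have [_ -> _] := chP i; split; [exact: line_segment_l|exact: line_segment_r].
Qed.

Let incP i z : z \in Q -> ln i z -> W z -> inc i (nu z).
Proof. by move=> zQ iz Wz; apply/asboolP; exists z. Qed.

Let inc_al i : inc i (al i).
Proof. by rewrite pointE; have [[? ?] _] := ch_in i; exact: incP. Qed.

Let inc_be i : inc i (be i).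
Proof. by rewrite pointE; have [_ [? ?]] := ch_in i; exact: incP. Qed.

Let inc_bounds i n : inc i n -> (al i <= n <= be i)%N.
Proof.
move=> /asboolP[z [zQ iz Wz <-]]; rewrite !pointE.
have [lt eq _] := chP i; have : (ln i `&` W) z by [].
rewrite eq => /(segment_lex lt)[h1 h2]; apply/andP; split.
  by case: h1 => [->//|/nu_lt h]; apply/ltnW/h.
by case: h2 => [->//|/nu_lt h]; apply/ltnW/h.
Qed.

Let meet_uniq i j n n' : i != j -> inc i n -> inc j n -> inc i n' -> inc j n' -> n = n'.
Proof.
move=> ij /asboolP[z [zQ iz Wz <-]] /asboolP[z1 [z1Q jz1 _ e1]].
move=> /asboolP[z' [z'Q iz' _ <-]] /asboolP[z2 [z2Q jz2 _ e2]].
rewrite (nu_inj z1Q zQ e1) in jz1; rewrite (nu_inj z2Q z'Q e2) in jz2.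
by rewrite (lines_meet_once ij iz jz1 iz' jz2).
Qed.

Let extreme_compat i j n : inc i n -> inc j n -> n = al j \/ n = be j ->
  n = al i \/ n = be i.
Proof.
move=> /asboolP[z [zQ iz Wz <-]] /asboolP[z1 [z1Q jz1 _ e1]].
rewrite (nu_inj z1Q zQ e1) in jz1; rewrite !pointE.
have [_ _ Hi] := chP i; have [_ _ Hj] := chP j.
have bW : (nu z = nu (ch j).1 \/ nu z = nu (ch j).2) -> boundary W z.
  by move=> H; apply/(Hj z jz1); case: H => /nu_inj h; [left|right]; exact: h.
by move/bW/(Hi z iz) => -[->|->]; [left|right].
Qed.

Definition ends_of T (ab : 'I_k -> V * V) := forall i,
  [/\ lexlt (ab i).1 (ab i).2, line_segment (ab i).1 (ab i).2 `<=` ln i &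
      segment T (line_segment (ab i).1 (ab i).2)].

Lemma ends_exist T : exists ab, T_tessellations_on W L T -> ends_of T ab.
Proof.
have [[TT TL]|nT] := pselect (T_tessellations_on W L T); last first.
  by exists (fun=> (0, 0)).
have PT : polygonal_tessellation W T by case: TT.
have H i : exists ab : V * V, [/\ lexlt ab.1 ab.2, line_segment ab.1 ab.2 `<=` ln i &
    segment T (line_segment ab.1 ab.2)].
  have : supporting_lines T (ln i) by rewrite TL; exists i.
  move=> [_ [s [Ss sl]]]; have [a [b [ab sab]]] := union_structure PT cW Ss.1.
  by exists (a, b); rewrite /= -sab; split.
by exists (projT1 (choice H)) => _ i; exact: (projT2 (choice H)).
Qed.

Let ends : set (set V) -> 'I_k -> V * V := projT1 (choice ends_exist).

Let endsP T : T_tessellations_on W L T -> ends_of T (ends T).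
Proof. exact: (projT2 (choice ends_exist)). Qed.

Let cfg T : config 'I_k N := [ffun i => (point (ends T i).1, point (ends T i).2)].

Section OneTessellation.

Variable T : set (set V).
Hypothesis TL : T_tessellations_on W L T.

Let TT : T_tessellation W T. Proof. by case: TL. Qed.
Let PT : polygonal_tessellation W T. Proof. by case: TT. Qed.

Let seg i := line_segment (ends T i).1 (ends T i).2.

Lemma segment_of_line s : segment T s -> exists i, s = seg i.
Proof.
move=> Ss; have [E [_ _ _ [l [Ll sl]] _]] := Ss.1.
have : supporting_lines T l by split=> //; exists s.
have [_ ->] := TL => -[i _ il]; exists i; apply: contrapT => ne.
have [_ sub Si] := endsP TL i; have [_ _ nal] := TT.
by apply: (nal _ _ Ss Si ne); exists (ln i); split=> //; rewrite il.
Qed.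

Lemma edges_union : \bigcup_(e in edge T) e = \bigcup_i seg i.
Proof.
apply/seteqP; split=> z.
  move=> [e Ee ez]; have [s Ss es] := segment_exists Ee.
  by have [i esi] := segment_of_line Ss; exists i => //; rewrite -esi; exact: es.
move=> [i _ iz]; have [_ _ [[E [ET _ sE _ _]] _]] := endsP TL i.
by move: iz; rewrite /seg sE => -[e /ET Ee ez]; exists e.
Qed.

Lemma seg_in_W i z : seg i z -> W z.
Proof.
have [_ _ [[E [ET _ sE _ _]] _]] := endsP TL i.
by rewrite /seg sE => -[e /ET Ee ez]; exact: (edge_sub PT Ee).
Qed.

Lemma seg_inj i j a b : a != b -> seg i a -> seg i b -> ln j a -> ln j b -> i = j.
Proof.
move=> ab ia ib ja jb; have [_ sub _] := endsP TL i; apply: ln_inj.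
exact: (is_line_eq (ln_line i) (ln_line j) (sub _ ia) (sub _ ib) ja jb ab).
Qed.

Lemma seg_end_cases i a b : a != b -> seg i = line_segment a b ->
  boundary W a \/ exists2 j, j != i & strict (seg j) a.
Proof.
move=> ab sab; have [_ _ Si] := endsP TL i.
case: (segment_end TT cW Si ab sab) => [|[s Ss [ne sa]]]; first by left.
have [j ej] := segment_of_line Ss; right; exists j; last by rewrite -ej.
by apply: contra_notN ne => /eqP ji; rewrite ej ji.
Qed.

Lemma strict_seg_line j a : strict (seg j) a -> ln j a.
Proof.
move=> sa; have [_ sub _] := endsP TL j; apply: sub.
exact: strict_mem (@convex_line_segment _ _ _) sa.
Qed.

Lemma seg_end_listed i a b : a != b -> seg i = line_segment a b -> a \in Q.
Proof.
move=> ab sab; have [_ sub _] := endsP TL i; have [_ _ Hi] := chP i.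
have ia : ln i a by apply: sub; rewrite -/(seg i) sab; exact: line_segment_l.
case: (seg_end_cases ab sab) => [/(Hi a ia)[->|->] //|[j ji sa]].
by rewrite (ptP _ (strict_seg_line sa) ia).
Qed.

Let neq_ends i : (ends T i).1 != (ends T i).2.
Proof. by have [h _ _] := endsP TL i; exact: lexlt_neq. Qed.

Lemma ends_listed i : (ends T i).1 \in Q /\ (ends T i).2 \in Q.
Proof.
split; first exact: (seg_end_listed (neq_ends i) (erefl _)).
apply: (@seg_end_listed i _ (ends T i).1); first by rewrite eq_sym neq_ends.
exact: line_segment_sym.
Qed.

Let lo_cfg i : lo (cfg T) i = nu (ends T i).1.
Proof. by rewrite /lo ffunE /= pointE. Qed.

Let hi_cfg i : hi (cfg T) i = nu (ends T i).2.
Proof. by rewrite /hi ffunE /= pointE. Qed.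

Let ends_on i : (ln i `&` W) (ends T i).1 /\ (ln i `&` W) (ends T i).2.
Proof.
have [_ sub _] := endsP TL i.
split; split; [exact: sub (line_segment_l _ _)|exact: seg_in_W (line_segment_l _ _)|
  exact: sub (line_segment_r _ _)|exact: seg_in_W (line_segment_r _ _)].
Qed.

Let inside_cfg j a : a \in Q -> strict (seg j) a -> inside inc (cfg T) j (nu a).
Proof.
move=> aQ sa; have [lt _ _] := endsP TL j; have [h1 h2] := strict_lex lt sa.
have [e1Q e2Q] := ends_listed j.
rewrite /inside lo_cfg hi_cfg !nu_lt // !andbT.
apply: incP => //; first exact: strict_seg_line.
exact: seg_in_W (strict_mem (@convex_line_segment _ _ _) sa).
Qed.

Lemma cfg_valid : valid inc al be [set: 'I_k]%SET (cfg T).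
Proof.
apply/validP; split=> [i _|i _|i _|i j n _ _ ij|i]; last by rewrite inE.
- have [lt _ _] := endsP TL i; have [e1Q e2Q] := ends_listed i.
  have [[l1 W1] [l2 W2]] := ends_on i.
  by rewrite lo_cfg hi_cfg; split; [exact: incP|exact: incP|exact: nu_lt].
- have [lt _ _] := endsP TL i; have [e1Q e2Q] := ends_listed i.
  have [[l1 W1] [l2 W2]] := ends_on i; rewrite lo_cfg.
  have [clt ceq Hi] := chP i.
  case: (seg_end_cases (neq_ends i) (erefl _)) => [/(Hi _ l1)[->|e]|[j ji sa]].
  + by left; rewrite pointE.
  (* The left end is not the right end of the chord, since the segment continues to its right. *)
  + have : (ln i `&` W) (ends T i).2 by [].
    rewrite ceq => /(segment_lex clt)[_ [h|h]]; rewrite e in lt.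
      by rewrite h lexlt_irr in lt.
    by have := lexlt_trans lt h; rewrite lexlt_irr.
  + by right; apply/blockedP; exists j; split; rewrite ?inE //; exact: inside_cfg.
- have [lt _ _] := endsP TL i; have [e1Q e2Q] := ends_listed i.
  have [[l1 W1] [l2 W2]] := ends_on i; rewrite hi_cfg.
  have [clt ceq Hi] := chP i.
  have ne : (ends T i).2 != (ends T i).1 by rewrite eq_sym neq_ends.
  case: (seg_end_cases ne (line_segment_sym _ _)) => [/(Hi _ l2)[e|->]|[j ji sa]].
  + have : (ln i `&` W) (ends T i).1 by [].
    rewrite ceq => /(segment_lex clt)[[h|h] _]; rewrite e in lt.
      by rewrite h lexlt_irr in lt.
    by have := lexlt_trans lt h; rewrite lexlt_irr.
  + by left; rewrite pointE.
  + by right; apply/blockedP; exists j; split; rewrite ?inE //; exact: inside_cfg.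
- rewrite /inside !lo_cfg !hi_cfg => /andP[/asboolP[z [zQ iz Wz <-]] /andP[z1 z2]].
  move=> /andP[/asboolP[z' [z'Q jz' _ e]] /andP[z3 z4]].
  rewrite (nu_inj z'Q zQ e) in jz'.
  have [i1Q i2Q] := ends_listed i; have [j1Q j2Q] := ends_listed j.
  have [lti subi Si] := endsP TL i; have [ltj subj Sj] := endsP TL j.
  have sti : strict (seg i) z.
    by apply: (lex_strict (ln_line i)); [apply: subi; exact: line_segment_l|
      apply: subi; exact: line_segment_r|by []|exact: lt_nu|exact: lt_nu].
  have stj : strict (seg j) z.
    by apply: (lex_strict (ln_line j)); [apply: subj; exact: line_segment_l|
      apply: subj; exact: line_segment_r|by []|exact: lt_nu|exact: lt_nu].
  have eij := segment_not_crossing TT cW Si Sj sti stj.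
  move/eqP: ij; apply; apply: (seg_inj (neq_ends i)); rewrite /seg.
  + exact: line_segment_l.
  + exact: line_segment_r.
  + by apply: subj; rewrite -eij; exact: line_segment_l.
  + by apply: subj; rewrite -eij; exact: line_segment_r.
Qed.

End OneTessellation.

Lemma cfg_inj T T' : T_tessellations_on W L T -> T_tessellations_on W L T' ->
  cfg T = cfg T' -> T = T'.
Proof.
move=> TL TL' e; have [[PT _ _] _] := TL; have [[PT' _ _] _] := TL'.
apply: (tessellation_determined PT PT'); rewrite !edges_union //.
apply: eq_bigcupr => i _.
have [h1 h2] := ends_listed TL i; have [h1' h2'] := ends_listed TL' i.
have := congr1 (fun f : config 'I_k N => f i) e; rewrite !ffunE => -[].
move=> /(congr1 val) + /(congr1 val); rewrite /= !pointE => e1 e2.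
by rewrite (nu_inj h1 h1' e1) (nu_inj h2 h2' e2).
Qed.

(** The number [n] carries the integer bound over to [final_bound], whose constant depends neither
    on the lines nor on [W]. *)
Lemma card_T_tessellations : (1 < k)%N -> exists n,
  (n * trunc_log 2 k ^ k <= 2 ^ (273 * k) * k ^ k)%N /\
  (counting (T_tessellations_on W L) <= (n%:R : R)%:E)%E.
Proof.
move=> k1; pose S := [set c : config 'I_k N | valid inc al be [set: 'I_k]%SET c]%SET.
exists #|S|; split.
  have := card_valid inc_al inc_be inc_bounds meet_uniq extreme_compat.
  by rewrite card_ord => /(_ k1).
pose h T : nat := index (cfg T) (enum S).
have hS T : T_tessellations_on W L T -> cfg T \in enum S.
  by move=> TL; rewrite mem_enum inE; exact: cfg_valid.
have h_inj : {in T_tessellations_on W L &, injective h}.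
  move=> T T' /set_mem TL /set_mem TL' e; apply: cfg_inj => //.
  by rewrite -(nth_index (cfg T) (hS T TL)) -[RHS](nth_index (cfg T) (hS T' TL')) -/(h T) e.
have le : (T_tessellations_on W L #<= `I_#|S|)%card.
  rewrite -(card_le_eql (inj_card_eq h_inj)); apply: subset_card_le => _ [T TL <-] /=.
  by rewrite cardE index_mem; exact: hS.
have fin : finite_set (T_tessellations_on W L) by exact: card_le_finite le (finite_II _).
rewrite /counting asboolT // lee_fin ler_nat; exact: geq_card_fset_set.
Qed.

End Counting.

(** * The asymptotic bound *)

Section Asymptotics.

Variable R : realType.

Lemma ln_le_sub1 (x : R) : 0 < x -> ln x <= x - 1.
Proof.
move=> x0; have := @le_ln1Dx R (x - 1); rewrite [1 + _]addrC subrK; apply; lra.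
Qed.

Lemma ln_ge_1subV (x : R) : 0 < x -> 1 - x^-1 <= ln x.
Proof.
move=> x0; have := @ln_le_sub1 x^-1; rewrite invr_gt0 lnV ?posrE // => /(_ x0); lra.
Qed.

Lemma ln2_itv : 2^-1 <= ln (2 : R) <= 1.
Proof.
have two0 : 0 < 2 :> R by [].
by have := ln_ge_1subV two0; have := ln_le_sub1 two0; lra.
Qed.

(** With m the truncated logarithm, ln k <= (m + 1) ln 2 <= m + 1 <= 2 m. *)
Lemma trunc_log_ge_ln k : (1 < k)%N -> ln k%:R / 2 <= (trunc_log 2 k)%:R :> R.
Proof.
move=> k1; have /andP[_ hk] := trunc_log_bounds (isT : (1 < 2)%N) (ltnW k1).
have lam1 : (1 <= trunc_log 2 k)%N by rewrite lt0n; apply: contraTneq hk => ->; rewrite -leqNgt.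
set m := trunc_log 2 k in hk lam1 *.
have kp : 0 < k%:R :> R by rewrite ltr0n ltnW.
have : ln (k%:R : R) <= ln (2 ^+ m.+1).
  by rewrite ler_ln ?posrE ?exprn_gt0 // -natrX ler_nat ltnW.
rewrite lnXn // -[_ *+ m.+1]mulr_natr -[m.+1%:R]natr1 => h.
have {}lam1 : 1 <= m%:R :> R by rewrite ler1n.
have /andP[_ l2] := ln2_itv.
have : ln (2 : R) * (m%:R + 1) <= 1 * (m%:R + 1) by apply: ler_wpM2r => //; lra.
lra.
Qed.

(** For x = ln k, the logarithms per line of the bound obtained and of the bound wanted. With y = ln
    x they differ by 1 - e y - (1 - e) y / x, where y >= -1 and |y / x| <= 2. *)
Lemma exponent_bound (e x : R) : 0 < e -> 2^-1 <= x ->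
  x - ln x <= (1 + e + 2 * `|1 - e|) + (1 - x^-1) * (x - (1 - e) * ln x).
Proof.
move=> e0 x2; have x0 : 0 < x by lra.
set y := ln x; have yl : y <= x - 1 := ln_le_sub1 x0; have yg : 1 - x^-1 <= y := ln_ge_1subV x0.
have xV2 : x^-1 <= 2 by rewrite -[2]invrK lef_pV2 ?posrE.
have xx : x^-1 * x = 1 by rewrite mulVf // gt_eqF.
have V0 : 0 < x^-1 by rewrite invr_gt0.
have y1 : - e <= e * y by nra.
have yx : `|x^-1 * y| <= 2.
  by rewrite ler_norml; apply/andP; split; nra.
have : `|(1 - e) * (x^-1 * y)| <= `|1 - e| * 2 by rewrite normrM ler_wpM2l.
rewrite ler_norml => /andP[h _].
have -> : (1 - x^-1) * (x - (1 - e) * y) =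
  x - 1 - y + e * y + (1 - e) * (x^-1 * y) by rewrite mulrBl mulrBr [x^-1 * (_ - _)]mulrBr xx; ring.
lra.
Qed.

Lemma final_bound (eps : R) : 0 < eps -> exists C : R, forall n k, (1 < k)%N ->
  (n * trunc_log 2 k ^ k <= 2 ^ (273 * k) * k ^ k)%N ->
  n%:R <= C ^+ k * (k%:R / (ln k%:R) `^ (1 - eps)) `^ (k%:R - k%:R / ln k%:R).
Proof.
(* One factor 2 beyond 2^273 pays for ln k / 2 in place of the truncated logarithm; the exponential
   is the constant of [exponent_bound]. *)
move=> e0; exists (2 ^+ 274 * expR (1 + eps + 2 * `|1 - eps|)) => n k k1 H.
set x := ln (k%:R : R); set c := 1 + eps + _.
have kp : 0 < k%:R :> R by rewrite ltr0n ltnW.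
have x2 : 2^-1 <= x.
  have /andP[h _] := ln2_itv; apply: le_trans h _.
  by rewrite ler_ln ?posrE // (ler_nat R 2 k).
have x0 : 0 < x by lra.
have lam := trunc_log_ge_ln k1; rewrite -/x in lam.
have xp : 0 < x `^ (1 - eps) by exact: powR_gt0.
have -> : (k%:R / x `^ (1 - eps)) `^ (k%:R - k%:R / x) =
    expR (k%:R * ((1 - x^-1) * (x - (1 - eps) * ln x))).
  rewrite /powR gt_eqF ?divr_gt0 //; congr expR.
  by rewrite ln_div ?posrE // ln_powR -/x; ring.
have step : n%:R <= (2 ^+ 274) ^+ k * (k%:R / x) ^+ k :> R.
  have : (n%:R : R) * (x / 2) ^+ k <= 2 ^+ (273 * k) * k%:R ^+ k.
    move: H; rewrite -(ler_nat R) !natrM !natrX; apply: le_trans.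
    by apply: ler_wpM2l => //; apply: lerXn2r => //; rewrite nnegrE; lra.
  rewrite -ler_pdivlMr; last by rewrite exprn_gt0 // divr_gt0.
  move/le_trans; apply; rewrite exprM -!exprMn -exprVn -exprMn.
  rewrite (exprS _ 273) le_eqVlt; apply/orP; left; apply/eqP; congr (_ ^+ k);
    by field; rewrite gt_eqF.
apply: le_trans step _; rewrite [X in _ <= X * _]exprMn -mulrA ler_wpM2l ?exprn_ge0 //.
have -> : k%:R / x = expR (x - ln x) by rewrite expRD expRN !lnK ?posrE.
rewrite -!expRM_natl -expRD ler_expR -mulrDr ler_wpM2l //.
exact: exponent_bound.
Qed.

End Asymptotics.

(** The midpoint of an inner edge is interior to [W]. So a single tessellation on [L] already
    ensures that all its lines have chords. *)
Lemma line_meets_interior (R : realType) (W : set 'rV[R]_2) L T l :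
  T_tessellations_on W L T -> L l -> exists z, l z /\ W° z.
Proof.
move=> [[PT _ _] <-] [_ [s [[[E [ET [e Ee] sE _ _]] _] sl]]].
have [_ [a [b [/eqP ab eab]]]] := ET _ Ee.
have h01 : 0 < (2^-1 : R) < 1 by apply/andP; split; lra.
exists (a + 2^-1 *: (b - a)); split; last exact: (edge_interior_domain PT (ET _ Ee) eab ab h01).
apply: sl; rewrite sE; exists e => //; rewrite eab; apply/line_segmentP.
by exists 2^-1 => //; apply/andP; split; lra.
Qed.

Lemma lines_indexed (T : pointedType) (L : set T) k : (L #= `I_k)%card ->
  exists f : 'I_k -> T, injective f /\ L = [set f i | i in [set: 'I_k]].
Proof.
rewrite card_eq_sym => /pcard_eqP[f]; exists (fun i : 'I_k => f i); split.
  by move=> i j fij; apply: val_inj; apply: (inj (f := f)); rewrite ?inE //; exact: ltn_ord.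
apply/seteqP; split=> x; last by move=> [i _ <-]; apply: funS; exact: ltn_ord.
by move=> /(@surj _ _ _ _ f)[n nk <-]; exists (Ordinal nk).
Qed.

Unset Implicit Arguments.

Theorem theorem2p1 (R : realType) (eps : R) (heps : 0 < eps) :
  exists C : R, forall (W : set 'rV[R]_2) (k : nat),
    planar_domain W -> (2 <= k)%N ->
    (max_T_tessellations W k <=
       (C ^+ k * (k%:R / (ln k%:R) `^ (1 - eps))
                   `^ (k%:R - k%:R / ln k%:R))%:E)%E.
Proof.
have [C HC] := final_bound heps; exists C => W k PW k2.
apply: ge_ereal_sup => _ [L [Lline Lk] <-].
(* Lines that miss the interior of [W] carry no tessellation; then [HC] at 0 says that the bound is
   non-negative. *)
have [[T TL]|/nonemptyPn->] := pselect (T_tessellations_on W L !=set0); last first.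
  rewrite /counting asboolT // fset_set0 lee_fin; exact: (HC 0%N k).
have [ln [ln_inj Lln]] := lines_indexed Lk.
have ln_line i : is_line (ln i) by apply: Lline; rewrite Lln; exists i.
have ln_meets i : exists z, ln i z /\ W° z.
  by apply: (line_meets_interior TL); rewrite Lln; exists i.
have [n [/(HC n k k2) n_le count_le]] := card_T_tessellations PW ln_line ln_inj ln_meets k2.
by rewrite Lln; apply: le_trans count_le _; rewrite lee_fin.
Qed.
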